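(* Let $G$ be a cubic graph which has a $1$-factor and $G \neq K_2^3$. For each $i \in \{3,4\}$ there is a smallest $i$-minimal set $X_i$ in $G$, and 1) if $G$ is bipartite, then $|X_3| = 0$ and $|X_4| = 2$; 2) if $G$ is $3$-edge-colorable and not bipartite, then $2 \le |X_3| \le 3(\frac{1}{2}|V(G)| - \alpha(G))$ and $|X_4| = 0$; 3.1) if $G$ is not $3$-edge-colorable, then $r(G) \le |X_4| \le \omega(G) \le |X_3| \le \min\{3(\frac{1}{2}|V(G)| - \alpha(G)), \frac{1}{2}|V(G)|\}$; 3.2) if $G$ is a snark, then $r(G) \le |X_4| \le \omega(G) < |X_3| \le \min\{3(\frac{1}{2}|V(G)| - \alpha(G)), \frac{1}{2}|V(G)|\}$.
   Context: Graphs are finite and may have parallel edges but no loops. A $k$-factor is a spanning $k$-regular subgraph. $K_2^3$ is the cubic graph on two vertices which are connected by three parallel edges. $\alpha(G)$ is the independence number of $G$. For a cubic graph $G$ with a $2$-factor, the oddness $\omega(G)$ is the minimum number of odd circuits of a $2$-factor of $G$. The resistance $r(G)$ of a cubic graph is the cardinality of a minimum color class, where the minimum is taken over all proper $4$-edge-colorings of $G$ (color classes may be empty, so $r(G)=0$ iff $G$ is $3$-edge-colorable). A snark is a bridgeless cubic graph which is not $3$-edge-colorable. A signed graph $(G,\sigma)$ is a graph $G$ with a function (signature) $\sigma: E(G)\to\{\pm1\}$; $N_\sigma=\{e:\sigma(e)=-1\}$. Each edge $e=uv$ is divided into two half-edges $h_e^u$ (incident with $u$) and $h_e^v$ (incident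 with $v$); $H(G)$ is the set of half-edges, $H(v)$ the set of half-edges incident with $v$, and $e_h$ the edge containing the half-edge $h$. An orientation of $(G,\sigma)$ is a function $\tau: H(G)\to\{\pm1\}$ with $\tau(h_e^u)\tau(h_e^v) = -\sigma(e)$ for each edge $e=uv$. Given an orientation $\tau$, the boundary of $f:E(G)\to\mathbb{R}$ is $\delta f(v)=\sum_{h\in H(v)}\tau(h)f(e_h)$. For real $r\ge 2$, $f$ is an $r$-flow on $(G,\sigma)$ if, for every edge $e$, $f(e)=0$ or $1\le |f(e)|\le r-1$, and $\delta f(v)=0$ for all $v\in V(G)$; it is nowhere-zero if $f(e)\ne 0$ for all $e$. $(G,\sigma)$ admits a nowhere-zero $r$-flow if one exists for some orientation. $F_c((G,\sigma))=\inf\{r : (G,\sigma)\text{ admits a nowhere-zero }r\text{-flow}\}$ (it is $\infty$ if there is no such $r$). For real $r\ge 2$, a set $X\subseteq E(G)$ is $r$-minimal if 1) the signature $\sigma$ of $G$ with $N_\sigma=X$ satisfies $F_c((G,\sigma))=r$, and 2) $F_c((G,\sigma'))\neq r$ for every signature $\sigma'$ of $G$ with $N_{\sigma'}$ a proper subset of $X$. An $r$-minimal set $X$ is a smallest $r$-minimal set if $|X|\le|X'|$ for every $r$-minimal set $X'$ of $G$.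
   Formalization: Besides K_2^3, the empty graph and all disjoint unions of copies of K_2^3 are excluded: the empty graph has no 3-minimal set, and unions of copies of K_2^3 have no 4-minimal set. For connected non-empty graphs this is just G ≠ K_2^3. *)

(* Defs.v *)
From HB Require Import structures.
From mathcomp Require Import all_boot all_order all_algebra.
From mathcomp Require Import all_classical all_reals ereal.

Set Implicit Arguments.
Unset Strict Implicit.
Unset Printing Implicit Defensive.

Import Order.TTheory GRing.Theory Num.Theory.
Local Open Scope ring_scope.

(** * Finite loopless multigraphs *)

(* Distinct edges may have the same two-element set of ends (parallel edges);
   loops are excluded because every edge has exactly two ends. *)
Record multigraph := Multigraph {
  vertex : finType;
  edge : finType;
  ends : edge -> {set vertex};
  card_ends : forall e, #|ends e| = 2
}.

Definition isomorphic (G H : multigraph) : Prop :=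
  exists (phi : vertex G -> vertex H) (psi : edge G -> edge H),
    [/\ bijective phi, bijective psi &
        forall e, ends (psi e) = [set phi x | x in ends e]].

Lemma card_ends_K23 (e : 'I_3) : #|[set: 'I_2]| = 2.
Proof. by rewrite cardsT card_ord. Qed.

Definition K23 : multigraph :=
  @Multigraph 'I_2 'I_3 (fun=> [set: 'I_2]) card_ends_K23.

Lemma card_ends_copies n (G : multigraph) (p : 'I_n * edge G) :
  #|[set (p.1, x) | x in ends p.2]| = 2.
Proof. by rewrite card_imset ?card_ends // => x y []. Qed.

(* The disjoint union of n copies of G; it is empty for n = 0. *)
Definition copies n (G : multigraph) : multigraph :=
  @Multigraph ('I_n * vertex G)%type ('I_n * edge G)%type
    (fun p => [set (p.1, x) | x in ends p.2]) (@card_ends_copies n G).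

Section Graphs.
Variable G : multigraph.
Implicit Types (F C : {set edge G}) (S : {set vertex G}) (v : vertex G).

Definition is_factor (k : nat) F : bool :=
  [forall v, #|[set e in F | v \in ends e]| == k].

Definition cubic : bool := is_factor 3 [set: edge G].

(* Adjacency in the spanning subgraph with edge set F. *)
Definition adj F : rel (vertex G) :=
  fun u v => [exists e in F, ends e == [set u; v]].

Definition bipartite : bool :=
  [exists A : {set vertex G}, forall e, #|ends e :&: A| == 1%N].

Definition bridge (e : edge G) : bool :=
  ~~ [forall u in ends e, forall v in ends e, connect (adj (~: [set e])) u v].

Definition bridgeless : bool := [forall e, ~~ bridge e].

Definition independent S : bool := [forall e, ~~ (ends e \subset S)].

Definition independence_number : nat :=
  \max_(S : {set vertex G} | independent S) #|S|.

(* A circuit, given by its edge set: a nonempty connected 2-regular subgraph.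
   Two parallel edges form a circuit of length 2. *)
Definition is_circuit C : bool :=
  [&& C != finset.set0,
      [forall v, #|[set e in C | v \in ends e]| \in [:: 0; 2]%N] &
      [forall e in C, forall f in C, forall u in ends e, forall v in ends f,
         connect (adj C) u v]].

Definition odd_circuits F : nat :=
  #|[set C : {set edge G} | [&& C \subset F, is_circuit C & odd #|C|]]|.

(* The default value #|edge G| of the minimum is harmless: the circuits of a
   2-factor are disjoint and nonempty, so there are at most #|edge G| of them. *)
Definition oddness : nat :=
  \big[minn/#|edge G|]_(F : {set edge G} | is_factor 2 F) odd_circuits F.

Definition proper_edge_coloring k (c : {ffun edge G -> 'I_k}) : bool :=
  [forall e, forall f,
     (e != f) && (ends e :&: ends f != finset.set0) ==> (c e != c f)].

Definition edge_colorable (k : nat) : bool :=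
  [exists c : {ffun edge G -> 'I_k}, proper_edge_coloring c].

(* Colour classes have at most #|edge G| elements, and loopless cubic graphs
   are 4-edge-colorable. *)
Definition resistance : nat :=
  \big[minn/#|edge G|]_(c : {ffun edge G -> 'I_4} | proper_edge_coloring c)
     \big[minn/#|edge G|]_(i < 4) #|[set e | c e == i]|.

Definition snark : bool := [&& cubic, bridgeless & ~~ edge_colorable 3].

(** * Signed graphs and flows *)

(* As there are no loops, the half-edge of e at its end v is the pair (e, v). *)
Definition half_edge : finType :=
  {h : edge G * vertex G | h.2 \in ends h.1}.

Definition hedge (h : half_edge) : edge G := (val h).1.
Definition hvertex (h : half_edge) : vertex G := (val h).2.

Definition is_sign (x : int) : Prop := x = 1 \/ x = -1.

Definition is_signature (sigma : edge G -> int) : Prop :=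
  forall e, is_sign (sigma e).

Definition negative_edges (sigma : edge G -> int) : {set edge G} :=
  [set e | sigma e == -1].

Definition is_orientation (sigma : edge G -> int) (tau : half_edge -> int) :
    Prop :=
  (forall h, is_sign (tau h)) /\
  (forall h h', hedge h = hedge h' -> h <> h' ->
     tau h * tau h' = - sigma (hedge h)).

Variable R : realType.
Implicit Types (f : edge G -> R) (r : R).

Definition boundary (tau : half_edge -> int) f (v : vertex G) : R :=
  \sum_(h : half_edge | hvertex h == v) (tau h)%:~R * f (hedge h).

Definition is_flow r (tau : half_edge -> int) f : Prop :=
  (forall e, f e = 0 \/ 1 <= `|f e| <= r - 1) /\
  (forall v, boundary tau f v = 0).

Definition admits_nowhere_zero_flow (sigma : edge G -> int) r : Prop :=
  exists (tau : half_edge -> int) f,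
    [/\ is_orientation sigma tau, is_flow r tau f & forall e, f e <> 0].

Definition circular_flow_number (sigma : edge G -> int) : \bar R :=
  ereal_inf [set (r%:E)%E | r in
    [set r : R | 2 <= r /\ admits_nowhere_zero_flow sigma r]%classic]%classic.

Definition is_minimal r (X : {set edge G}) : Prop :=
  (exists sigma, [/\ is_signature sigma, negative_edges sigma = X &
                     circular_flow_number sigma = r%:E]) /\
  (forall sigma', is_signature sigma' -> negative_edges sigma' \proper X ->
     circular_flow_number sigma' <> r%:E).

Definition is_smallest_minimal r (X : {set edge G}) : Prop :=
  is_minimal r X /\ (forall X', is_minimal r X' -> (#|X| <= #|X'|)%N).

End Graphs.

(* Main.v *)
From mathcomp Require Import all_classical all_reals ereal topology normedtype.
From mathcomp Require Import all_boot all_order all_algebra perm.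
From mathcomp Require Import zify lra.
Require Import Defs.
Set Implicit Arguments.
Unset Strict Implicit.
Unset Printing Implicit Defensive.
Import Order.TTheory GRing.Theory Num.Theory.
Import numFieldNormedType.Exports.

(** Multiply the value of an edge by the sign of each of its half-edges: a flow
    becomes a function on half-edges with sum 0 at every vertex, which takes
    equal values at the two ends of a negative edge and opposite values at the
    two ends of a positive one ([flow], [has_flowP]). Everything is proved for
    these functions.

    Flow number 3. In a cubic graph a flow with values of modulus in [1, 3)
    has at each vertex one large value and two small values of the opposite
    sign. The sign of the large value splits the vertices into two sides, and
    the negative edges are those inside a side, so they form the complement of
    a cut ([small_flow_cut]). Conversely the complement of any cut has a flow
    with values 1 and 2 when there is a 1-factor ([cut_flow]). Hence the flow
    number is 3 exactly on complements of cuts, and a smallest 3-minimal set is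
    the complement of a maximum cut. The bounds from above come from the cut
    around a maximum independent set and from moving one vertex across a
    maximum cut. Every odd circuit of a 2-factor meets the complement of a cut,
    so the oddness is a bound from below ([odd_circuits_cocut]); it is strict
    for a snark, because some 1-factor contains a given edge of the complement
    ([edge_in_factor]) and the odd circuits of the 2-factor left over then meet
    it in other edges. That 1-factor comes from the Tutte-Berge formula.

    Flow number 4. By compactness the flow number is at most 4 exactly when
    there is a flow with values of modulus in [1, 3] ([has_flow_closed]), so a
    smallest 4-minimal set is a smallest set of negative edges of such a flow
    which is not the complement of a cut.

    A 3-edge-colouring gives such a flow without negative edges, and a 2-factor
    gives one with one negative edge on each odd circuit, at a place of our
    choice ([half_coloring_flow], [broken_flow]). If two different choices on
    an odd circuit both gave complements of cuts, some edge of the 1-factor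
    would be a bridge, and there is an odd circuit where this does not happen
    ([odd_circuit_nonbridge], [broken_not_cocut]). No flow has exactly one
    negative edge ([no_flow_single]); in a bipartite graph two negative edges
    suffice unless all adjacent edges are parallel ([bipartite_four_flow]).

    Conversely, cut the negative edges of a flow with values in [1, 3] in two
    and round it to an integral flow ([integral_rounding]). Read modulo 4, it
    colours the positive edges properly with three colours
    ([flow_partial_coloring]). As long as two uncoloured edges are adjacent, a Kempe
    exchange makes one more edge coloured ([kempe_exchange]); once the
    uncoloured edges form a matching they are a colour class of a proper
    4-edge-colouring, so the resistance is a bound from below. *)

(** * Colourings from two involutions *)

Section Mate.
Variable T : finType.
Implicit Types (S : {set T}) (x y : T).

(** The other element of a set with two elements. It serves for the second end of
    an edge and for the second edge of a 2-factor at a vertex. *)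
Definition mate S x := if x \in S then odflt x [pick y in S :\ x] else x.

Lemma mate_id S x : x \notin S -> mate S x = x.
Proof. by rewrite /mate => /negbTE->. Qed.

Lemma mate_in S x : x \in S -> mate S x \in S.
Proof.
by rewrite /mate => xS; rewrite xS; case: pickP => // y; rewrite !inE => /andP[].
Qed.

Lemma mateE S x y : #|S| <= 2 -> x \in S -> y \in S -> x != y -> mate S x = y.
Proof.
move=> S2 xS yS xy; rewrite /mate xS; case: pickP => [z|/(_ y)]; last first.
  by rewrite !inE yS eq_sym xy.
rewrite !inE => /andP[zx zS] /=; apply/eqP/idPn => zy.
have : #|[set x; y; z]| <= #|S|.
  by apply/subset_leq_card/fintype.subsetP => t; rewrite !inE => /orP[/orP[]|] /eqP->.
by rewrite -setUA cardsU1 cards2 !inE negb_or xy eq_sym zx eq_sym zy leqNgt ltnS S2.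
Qed.

Lemma mate_neq S x : 1 < #|S| -> x \in S -> mate S x != x.
Proof.
move=> S2 xS; rewrite /mate xS; case: pickP => [z|/(_ _)/= H].
  by rewrite !inE => /andP[].
have : S :\ x = finset.set0 by apply/setP => y; rewrite H inE.
by move/eqP; rewrite -cards_eq0; move: S2; rewrite (cardsD1 x) xS ltnS lt0n => /negbTE->.
Qed.

Lemma mateK S : #|S| <= 2 -> involutive (mate S).
Proof.
move=> S2 x; case: (boolP (x \in S)) => xS; last by rewrite !mate_id // ?mate_id.
case: (eqVneq (mate S x) x) => [mx|mx]; first by rewrite !mx.
by apply: mateE; rewrite ?mate_in.
Qed.

End Mate.

(** A graph that is the union of two perfect matchings has only even circuits. In
    algebraic terms: if a power of [p := b \o a] sent [x] to [a x], then [x] would be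
    fixed by [a] times that power, a palindrome of odd length in [a] and [b]. Such a
    word is conjugate to [a] or [b] and has no fixed point. So [a] and [b] exchange
    the orbits of [p] in pairs, and one orbit of each pair gets [true]. *)
Lemma two_free_involutions (T : finType) (a b : T -> T) :
    involutive a -> involutive b ->
    (forall x, a x != x) -> (forall x, b x != x) ->
  exists c : T -> bool, forall x, c (a x) = ~~ c x /\ c (b x) = ~~ c x.
Proof.
move=> aK bK a_free b_free; pose p := b \o a.
have p_inj : injective p by apply: inj_comp; apply: inv_inj.
have p_a_p x : p (a (p x)) = a x by rewrite /p /= aK bK.
have iter_a n x : iter n p (a (iter n p x)) = a x.
  by elim: n x => // n IHn x; rewrite iterSr iterS p_a_p.
have iter_inj n : injective (iter n p) by elim: n => // i IH u v /p_inj/IH.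
have far x : ~~ fconnect p x (a x).
  apply/negP => /iter_findex; set k := findex _ _ _.
  rewrite -(odd_double_half k) -addnn addnCA iterD.
  set j := k./2 => Hk; have := iter_a j x; rewrite -Hk => /iter_inj.
  rewrite iterD; case: (odd k) => /= [ay|]; last exact/eqP/a_free.
  by have := b_free (a (iter j p x)); rewrite {2}ay /p /= eqxx.
have p_sym := fconnect_sym p_inj.
pose c x := (enum_rank (froot p x) < enum_rank (froot p (a x)))%N.
have ca x : c (a x) = ~~ c x.
  rewrite /c aK -leqNgt [in RHS]leq_eqVlt.
  case: eqP => // /ord_inj/enum_rank_inj/eqP.
  by rewrite (root_connect p_sym) p_sym (negbTE (far x)).
exists c => x; split=> //; rewrite -ca /c aK.
have -> : froot p (b x) = froot p (a x).
  by apply/eqP; rewrite (root_connect p_sym) p_sym -{2}(aK x) fconnect1.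
have -> : froot p (a (b x)) = froot p x => //.
by apply/eqP; rewrite (root_connect p_sym) -{2}(bK x) -{2}(aK (b x)) fconnect1.
Qed.

(** Fixed points are removed by doubling: on [T * bool] a fixed point of the
    first or second involution is moved to its own copy. *)
Lemma two_involutions (T : finType) (a b : T -> T) :
    involutive a -> involutive b ->
  exists c : T -> bool, forall x,
    (a x != x -> c (a x) = ~~ c x) /\ (b x != x -> c (b x) = ~~ c x).
Proof.
pose dbl (f : T -> T) (u : T * bool) := 
  if f u.1 == u.1 then (u.1, ~~ u.2) else (f u.1, u.2).
have dblK f : involutive f -> involutive (dbl f).
  move=> fK [x i]; rewrite /dbl /=; case: (eqVneq (f x) x) => /= fx.
    by rewrite fx eqxx negbK.
  by rewrite fK eq_sym (negbTE fx).
have dbl_free f u : dbl f u != u.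
  case: u => x i; rewrite /dbl /=; case: (eqVneq (f x) x) => [_|/negbTE fx].
    by rewrite xpair_eqE eqxx; case: i.
  by rewrite xpair_eqE fx.
move=> aK bK.
have [c cP] := two_free_involutions (dblK a aK) (dblK b bK) (dbl_free a) (dbl_free b).
exists (fun x => c (x, true)) => x; have [] := cP (x, true).
by rewrite /dbl /=; case: (eqVneq (a x) x); case: (eqVneq (b x) x).
Qed.

(** * Incidence and cuts *)

Section Basics.
Variable G : multigraph.
Implicit Types (A B S W : {set vertex G}) (F N M : {set edge G}).
Implicit Types (e f : edge G) (u v w x y : vertex G).

Definition inc v : {set edge G} := [set e | v \in ends e].

Definition opp e v : vertex G := mate (ends e) v.

Definition cutset A : {set edge G} := [set e | #|ends e :&: A| == 1].

Definition sdiff A B : {set vertex G} := [set x | (x \in A) (+) (x \in B)].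

(** The 2 of [card_ends] is a numeral of a ring, this one is a natural number. *)
Lemma card_ends2 e : #|ends e| = 2.
Proof. exact: card_ends. Qed.

Lemma in_inc v e : (e \in inc v) = (v \in ends e).
Proof. by rewrite inE. Qed.

Lemma opp_in e v : v \in ends e -> opp e v \in ends e.
Proof. exact: mate_in. Qed.

Lemma opp_neq e v : v \in ends e -> opp e v != v.
Proof. by apply: mate_neq; rewrite card_ends2. Qed.

Lemma oppK e : involutive (opp e).
Proof. by apply: mateK; rewrite card_ends2. Qed.

Lemma opp_eq e u v : u \in ends e -> v \in ends e -> u != v -> opp e u = v.
Proof. by apply: mateE; rewrite card_ends2. Qed.

Lemma ends_opp e v : v \in ends e -> ends e = [set v; opp e v].
Proof.
move=> ve; apply/esym/eqP; rewrite eqEcard card_ends2 cards2 eq_sym opp_neq //.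
by rewrite andbT; apply/fintype.subsetP => x; rewrite !inE => /orP[] /eqP-> //; exact: opp_in.
Qed.

Lemma ends_cases e u v : u \in ends e -> v \in ends e -> u = v \/ u = opp e v.
Proof. by move=> ue ve; move: ue; rewrite (ends_opp ve) !inE => /orP[] /eqP; [left|right]. Qed.

Lemma end_exists e : exists v, v \in ends e.
Proof. by apply/set0Pn; rewrite -card_gt0 card_ends2. Qed.

Lemma card_endsI e v A : v \in ends e ->
  #|ends e :&: A| = (v \in A) + (opp e v \in A).
Proof.
move=> ve; rewrite -sum1_card (eq_bigl (fun x => (x \in ends e) && (x \in A))).
  rewrite big_mkcondr /= (ends_opp ve) big_setU1 ?big_set1 /=; last first.
    by rewrite inE eq_sym opp_neq.
  by do 2!case: ifP.
by move=> x; rewrite inE.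
Qed.

Lemma in_cutset e v A : v \in ends e ->
  (e \in cutset A) = ((v \in A) != (opp e v \in A)).
Proof. by move=> ve; rewrite inE (card_endsI _ ve); do 2!case: (_ \in A). Qed.

Lemma cutset1 v : cutset [set v] = inc v.
Proof.
apply/setP => e; rewrite in_inc.
have [w we] := end_exists e; rewrite (in_cutset _ we) !inE (ends_opp we) !inE.
case: (eqVneq w v) => [<-|wv] /=; first by rewrite (negbTE (opp_neq we)).
by rewrite [RHS]eq_sym; case: (_ == v).
Qed.

Lemma in_cutset_sdiff A B e :
  (e \in cutset (sdiff A B)) = (e \in cutset A) (+) (e \in cutset B).
Proof.
have [v ve] := end_exists e; rewrite !(in_cutset _ ve) !inE.
by do 4!case: (_ \in _).
Qed.

Lemma double_count F S : \sum_(v in S) #|F :&: inc v| = \sum_(e in F) #|ends e :&: S|.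
Proof.
under eq_bigr => v _ do rewrite -sum1_card.
under [RHS]eq_bigr => e _ do rewrite -sum1_card.
rewrite (exchange_big_dep (mem F)) /=; last by move=> v e _; rewrite inE => /andP[].
apply: eq_bigr => e eF; apply: eq_bigl => v.
by rewrite !inE eF /= andbC.
Qed.

Lemma double_countT F : \sum_v #|F :&: inc v| = 2 * #|F|.
Proof.
have := double_count F [set: vertex G].
under eq_bigl do rewrite inE.
move=> ->; rewrite mulnC -sum_nat_const; apply: eq_bigr => e _.
by rewrite setIT card_ends2.
Qed.

Lemma factorP k F : reflect (forall v, #|F :&: inc v| = k) (is_factor k F).
Proof.
have E v : [set e in F | v \in ends e] = F :&: inc v by apply/setP => e; rewrite !inE.
by apply: (iffP forallP) => H v; move: (H v); rewrite E => /eqP.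
Qed.

(** In the sum of the degrees over [S] an edge inside [S] is counted twice. *)
Lemma odd_cut F S : odd #|F :&: cutset S| = odd (\sum_(v in S) #|F :&: inc v|).
Proof.
rewrite double_count (bigID (mem (cutset S))) /= oddD.
rewrite (eq_bigr (fun=> 1)); last by move=> e /andP[_]; rewrite inE => /eqP.
rewrite -[LHS]addbF; congr (_ (+) _).
  by rewrite -sum1_card; congr odd; apply: eq_bigl => e; rewrite inE.
apply/esym/negbTE; rewrite -dvdn2; apply: dvdn_sum => e /andP[_].
rewrite inE; have : #|ends e :&: S| <= 2 by rewrite -(card_ends2 e) subset_leq_card ?subsetIl.
by case: #|_| => [|[|[]]].
Qed.

(** Half-edges of a subgraph of maximum degree 2, where an edge may be present
    at one end only, are paired along the edges and at the vertices; these are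
    two involutions. The signs orient the paths and circuits of the subgraph
    consistently. *)
Lemma half_edge_signs (D : vertex G -> {set edge G}) :
    (forall v, D v \subset inc v) -> (forall v, #|D v| <= 2) ->
  exists s : vertex G -> edge G -> bool,
    (forall v e f, e \in D v -> f \in D v -> e != f -> s v f = ~~ s v e) /\
    (forall v e, e \in D v -> e \in D (opp e v) -> s (opp e v) e = ~~ s v e).
Proof.
move=> Dinc D2.
pose a (h : vertex G * edge G) := (h.1, mate (D h.1) h.2).
pose both (h : vertex G * edge G) := (h.2 \in D h.1) && (h.2 \in D (opp h.2 h.1)).
pose b h := if both h then (opp h.2 h.1, h.2) else h.
have aK : involutive a by case=> v e; rewrite /a /= mateK.
have bK : involutive b.
  case=> v e; rewrite /b; case bve: (both (v, e)); last by rewrite bve.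
  by move: bve; rewrite /both /= oppK andbC => ->.
have [c cP] := two_involutions aK bK.
exists (fun v e => c (v, e)); split=> [v e f eD fD ef|v e eD eD'].
  have [ca _] := cP (v, e); have := ca; rewrite /a /= (mateE _ eD fD) //; apply.
  by rewrite xpair_eqE eqxx eq_sym.
have [_] := cP (v, e); rewrite /b /both /= eD eD' /=; apply.
by rewrite xpair_eqE negb_and opp_neq //; have /fintype.subsetP/(_ e eD) := Dinc v; rewrite in_inc.
Qed.

(** A bipartite graph of maximum degree 2 is 2-edge-colorable: along an edge
    the half-edge sign changes together with the side. *)
Lemma bipartite_two_coloring A F :
    F \subset cutset A -> (forall v, #|F :&: inc v| <= 2) ->
  exists c : edge G -> bool,
    forall v e f, e \in F -> f \in F -> v \in ends e -> v \in ends f -> e != f ->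
      c f = ~~ c e.
Proof.
move=> FA F2.
have [s [s_v s_e]] := half_edge_signs (fun v => subsetIr F (inc v)) F2.
pose c e := [exists v in ends e, s v e (+) (v \in A)].
have cE e v : e \in F -> v \in ends e -> c e = s v e (+) (v \in A).
  move=> eF ve; have := fintype.subsetP FA _ eF; rewrite (in_cutset _ ve) => neA.
  have : s (opp e v) e = ~~ s v e by apply: s_e; rewrite !inE eF ?opp_in ?ve.
  move=> se; have E : s (opp e v) e (+) (opp e v \in A) = s v e (+) (v \in A).
    by rewrite se; move: neA; case: (s v e); do 2!case: (_ \in A).
  apply/existsP/idP => [[u /andP[ue]]|H]; last by exists v; rewrite ve.
  by have [->//|->] := ends_cases ue ve; rewrite E.
exists c => v e f eF fF ve vf ef; rewrite (cE _ v) // (cE _ v) //.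
by rewrite (s_v v e f) ?addNb // !inE ?eF ?fF.
Qed.

Section Cubic.
Hypothesis G_cubic : cubic G.

Lemma card_inc v : #|inc v| = 3.
Proof. by have /factorP/(_ v) := G_cubic; rewrite setTI. Qed.

Lemma inc_split v e : v \in ends e ->
  exists f h, [/\ e != f, e != h, f != h & inc v = [set e; f; h]].
Proof.
move=> ve; have : #|inc v :\ e| == 2 by move: (card_inc v); rewrite (cardsD1 e) in_inc ve add1n => -[->].
case/cards2P => f [h [fh E]].
have /setD1P[fe _] : f \in inc v :\ e by rewrite E !inE eqxx.
have /setD1P[he _] : h \in inc v :\ e by rewrite E !inE eqxx orbT.
exists f, h; split; rewrite // 1?eq_sym //.
by rewrite -setUA -E setD1K ?in_inc.
Qed.

Lemma factorC k F : is_factor k F -> k <= 3 -> is_factor (3 - k) (~: F).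
Proof.
move=> /factorP kF k3; apply/factorP => v.
have := card_inc v; rewrite -(cardsID F (inc v)) setIC kF setDE setIC => <-.
by rewrite addKn.
Qed.

Lemma card_edges : 2 * #|edge G| = 3 * #|vertex G|.
Proof.
have := double_countT [set: edge G]; rewrite cardsT => <-.
rewrite (eq_bigr (fun=> 3)); first by rewrite sum_nat_const mulnC; congr (_ * _); apply: eq_card.
by move=> v _; rewrite setTI card_inc.
Qed.

Lemma odd_cut_cubic S : odd #|cutset S| = odd #|S|.
Proof.
rewrite -[cutset S]setTI odd_cut (eq_bigr (fun=> 3)).
  by rewrite sum_nat_const oddM andbT.
by move=> v _; rewrite setTI card_inc.
Qed.

End Cubic.
End Basics.

(** * Flows as functions on half-edges *)

Section Flows.
Local Open Scope ring_scope.
Variables (R : realType) (G : multigraph).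
Implicit Types (N M F : {set edge G}) (A : {set vertex G}) (g : vertex G -> edge G -> R).
Implicit Types (e : edge G) (u v w : vertex G) (r : R).

(** [g v e] is the value of [e] times the sign of its half-edge at [v]; the last
    clause is the relation between the orientation and the signature whose negative edges
    are those of [N]. *)
Definition flow r N g : Prop :=
  [/\ forall v, \sum_(e in inc v) g v e = 0,
      forall v e, v \in ends e -> 1 <= `|g v e| <= r - 1
    & forall v e, v \in ends e -> g (opp e v) e = if e \in N then g v e else - g v e].

Definition has_flow r N : Prop := exists g, flow r N g.

(** An orientation, extended by 0 to the pairs that are not half-edges. *)
Definition half_sign (tau : half_edge G -> int) v e : R :=
  if insub (e, v) is Some h then (tau h)%:~R else 0.

Lemma half_signE tau (h : half_edge G) : half_sign tau (hvertex h) (hedge h) = (tau h)%:~R.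
Proof. by rewrite /half_sign /hvertex /hedge -surjective_pairing valK. Qed.

Lemma half_edge_at v e : v \in ends e -> exists h : half_edge G, hvertex h = v /\ hedge h = e.
Proof. by move=> ve; exists (exist _ (e, v) ve). Qed.

Lemma hvertex_in (h : half_edge G) : hvertex h \in ends (hedge h).
Proof. exact: (valP h). Qed.

Lemma half_edge_inj (h k : half_edge G) : hvertex h = hvertex k -> hedge h = hedge k -> h = k.
Proof.
rewrite /hvertex /hedge => hv he; apply: val_inj.
by rewrite [val h]surjective_pairing hv he -surjective_pairing.
Qed.

Lemma boundaryE tau (f : edge G -> R) v :
  boundary tau f v = \sum_(e in inc v) half_sign tau v e * f e.
Proof.
rewrite /boundary (partition_big (@hedge G) (mem (inc v))) /=; last first.
  by move=> h /eqP <-; rewrite in_inc hvertex_in.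
apply: eq_bigr => e; rewrite in_inc => ve.
have [h [hv he]] := half_edge_at ve.
rewrite (big_pred1 h) => [|k /=]; first by rewrite -hv -he half_signE.
apply/andP/eqP => [[/eqP kv /eqP ke]|->]; last by rewrite hv he !eqxx.
by apply: half_edge_inj; rewrite ?kv ?ke.
Qed.

Lemma has_flowP sigma r : is_signature sigma ->
  admits_nowhere_zero_flow sigma r <-> has_flow r (negative_edges sigma).
Proof.
move=> sig; split=> [[tau [f [[tau_sign tau_opp] [f_bound f_bd] f_nz]]]|[g [g_bd g_bound g_opp]]].
  exists (fun v e => half_sign tau v e * f e); split=> [v|v e ve|v e ve].
  - by rewrite -boundaryE f_bd.
  - have [h [<- <-]] := half_edge_at ve; rewrite half_signE normrM.
    have -> : `|(tau h)%:~R : R| = 1 by case: (tau_sign h) => ->; rewrite ?normrN normr1.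
    by rewrite mul1r; case: (f_bound (hedge h)) => // /f_nz.
  - have [h [hv he]] := half_edge_at ve; have [k [kv ke]] := half_edge_at (opp_in ve).
    have -> : half_sign tau (opp e v) e = (tau k)%:~R by rewrite -half_signE kv ke.
    have -> : half_sign tau v e = (tau h)%:~R by rewrite -half_signE hv he.
    have /tau_opp/(_ _) : hedge h = hedge k by rewrite he ke.
    have hk : h <> k by move=> hk; move: (opp_neq ve); rewrite -kv -hk hv eqxx.
    move=> /(_ hk); rewrite inE he; case: (sig e) => -> /=; 
    by case: (tau_sign h) => ->; case: (tau_sign k) => -> //=; rewrite ?(mulN1r, mul1r, opprK).
pose a_end e := xchoose (end_exists e).
have a_endP e : a_end e \in ends e := xchooseP (end_exists e).
pose f e := `|g (a_end e) e|.
pose tau (h : half_edge G) : int := if 0 < g (hvertex h) (hedge h) then 1 else -1.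
have fE v e : v \in ends e -> f e = `|g v e|.
  rewrite /f => ve; have [->//|->] := ends_cases (a_endP e) ve.
  by rewrite (g_opp _ _ ve); case: ifP; rewrite ?normrN.
have g_neq0 v e : v \in ends e -> g v e != 0.
  by move=> ve; have /andP[g1 _] := g_bound _ _ ve; rewrite -normr_gt0; apply: lt_le_trans g1.
have tau_f v e : v \in ends e -> half_sign tau v e * f e = g v e.
  move=> ve; rewrite (fE _ _ ve); have [h [<- <-]] := half_edge_at ve.
  rewrite half_signE /tau; case: ltP => [/gtr0_norm->|/ler0_norm->]; first by rewrite mul1r.
  by rewrite mulN1r opprK.
exists tau, f; split.
- split=> [h|h k hk h_k]; first by rewrite /tau; case: ifP; [left|right].
  have kE : hvertex k = opp (hedge h) (hvertex h).
    have kh : hvertex k \in ends (hedge h) by rewrite hk hvertex_in.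
    have [E|//] := ends_cases kh (hvertex_in h).
    by case: h_k; apply: half_edge_inj.
  have := g_neq0 _ _ (hvertex_in h); rewrite /tau -hk kE g_opp ?hvertex_in // inE.
  case: (sig (hedge h)) => -> /=; rewrite ?oppr_gt0; case: ltgtP; by rewrite ?eqxx.
- split=> [e|v].
    by right; rewrite /f normr_id; apply/g_bound/a_endP.
  by rewrite boundaryE -[RHS](g_bd v); apply: eq_bigr => e; rewrite in_inc => /tau_f.
- by move=> e; apply/eqP; rewrite /f normr_eq0 g_neq0.
Qed.

Lemma has_flow_le r s N : r <= s -> has_flow r N -> has_flow s N.
Proof.
move=> rs [g [g1 g2 g3]]; exists g; split=> // v e /g2 /andP[-> /= H].
by apply: le_trans H _; rewrite lerD2r.
Qed.

Lemma cfn_eq sigma r : is_signature sigma -> 2 <= r ->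
    has_flow r (negative_edges sigma) ->
    (forall s, has_flow s (negative_edges sigma) -> r <= s) ->
  circular_flow_number R sigma = r%:E.
Proof.
move=> sig r2 /(has_flowP _ sig) fr frmin; apply/eqP; rewrite eq_le; apply/andP; split.
  by apply: ereal_inf_lbound; exists r.
by apply/ereal_infP => _ [s [_ /(has_flowP _ sig)/frmin rs] <-]; rewrite lee_fin.
Qed.

Lemma cfn_approx sigma r s : is_signature sigma ->
  circular_flow_number R sigma = r%:E -> r < s -> has_flow s (negative_edges sigma).
Proof.
move=> sig E; rewrite -lte_fin -E => /ereal_inf_lt [_ [t [_ /(has_flowP _ sig) ft] <-]].
by rewrite lte_fin => /ltW ts; apply: has_flow_le ft.
Qed.

End Flows.

(** * Flows on cubic graphs *)

Section CubicFlows.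
Local Open Scope ring_scope.
Variables (R : realType) (G : multigraph).
Implicit Types (N M F : {set edge G}) (A W : {set vertex G}) (g : vertex G -> edge G -> R).
Implicit Types (e f h : edge G) (u v w : vertex G) (r : R).

Lemma sum_ends (phi : vertex G -> R) W e v : v \in ends e ->
  \sum_(x in W | x \in ends e) phi x =
    (if v \in W then phi v else 0) + (if opp e v \in W then phi (opp e v) else 0).
Proof.
move=> ve; rewrite (eq_bigl (fun x => (x \in ends e) && (x \in W))); last by move=> x; rewrite andbC.
rewrite big_mkcondr /= (ends_opp ve) big_setU1 ?big_set1 //=.
by rewrite inE eq_sym opp_neq.
Qed.

(** Sum the conservation law over [W]. A positive edge inside [W] contributes 0, so
    what remains are the cut edges and the negative edges inside [W]; there is
    never exactly one of them, since its value would be 0. *)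
Lemma flow_lone_edge r N g W e0 : flow r N g ->
    (forall e, e != e0 -> e \notin cutset W) ->
    (forall e v, e != e0 -> e \in N -> v \in ends e -> v \notin W) ->
    ~ (e0 \in cutset W \/ e0 \in N /\ ends e0 \subset W).
Proof.
move=> [g_bd g_bound g_opp] Wcut WN.
have g_neq0 v e : v \in ends e -> g v e != 0.
  by move=> ve; have /andP[g1 _] := g_bound _ _ ve; rewrite -normr_gt0; apply: lt_le_trans g1.
have : \sum_(v in W) \sum_(e in inc v) g v e = 0 by apply: big1 => v _; apply: g_bd.
rewrite (exchange_big_dep xpredT) //= (bigD1 e0) //=.
rewrite [X in _ + X]big1 => [|e ee0]; last first.
  have [v ve] := end_exists e.
  rewrite (eq_bigl (fun x => (x \in W) && (x \in ends e))) => [|x]; last by rewrite in_inc.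
  have := Wcut e ee0; rewrite (in_cutset _ ve) negbK (sum_ends (g ^~ e) _ ve) => /eqP <-.
  case: ifP => vW; last by rewrite addr0.
  rewrite g_opp //; case: ifP => [eN|_]; last by rewrite subrr.
  by have := WN e v ee0 eN ve; rewrite vW.
have [v ve] := end_exists e0.
rewrite (eq_bigl (fun x => (x \in W) && (x \in ends e0))) => [|x]; last by rewrite in_inc.
rewrite (sum_ends (g ^~ e0) _ ve) addr0 => Sum [|[e0N /fintype.subsetP e0W]].
  rewrite (in_cutset _ ve); move: Sum; case: ifP => vW; case: ifP => ovW //.
    by move/eqP; rewrite addr0 (negbTE (g_neq0 _ _ ve)).
  by move/eqP; rewrite add0r (negbTE (g_neq0 _ _ (opp_in ve))).
move: Sum; rewrite !e0W ?opp_in // g_opp // e0N => /eqP.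
by rewrite -mulr2n mulrn_eq0 /= (negbTE (g_neq0 _ _ ve)).
Qed.

Lemma no_flow_single r e : ~ has_flow r [set e].
Proof.
move=> [g gf]; apply: (flow_lone_edge (W := [set: vertex G]) (e0 := e) gf).
- by move=> f _; have [v vf] := end_exists f; rewrite (in_cutset _ vf) !inE.
- by move=> f v fe; rewrite inE (negbTE fe).
- by right; rewrite inE eqxx finset.subsetT.
Qed.

Lemma no_lone_cut r e W : has_flow r (finset.set0 : {set edge G}) -> cutset W <> [set e].
Proof.
move=> [g gf] We; apply: (flow_lone_edge (W := W) (e0 := e) gf).
- by move=> f fe; rewrite We inE.
- by move=> f v _; rewrite inE.
- by left; rewrite We inE.
Qed.

Hypothesis G_cubic : cubic G.

Lemma sum_inc (phi : edge G -> R) v e f h :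
    [/\ e != f, e != h, f != h & inc v = [set e; f; h]] ->
  \sum_(x in inc v) phi x = phi e + phi f + phi h.
Proof.
move=> [ef eh fh ->]; rewrite -setUA big_setU1 ?inE ?negb_or ?ef ?eh //=.
by rewrite big_setU1 ?big_set1 ?inE ?fh //= addrA.
Qed.

(** Among three values of modulus at least 1 with sum 0, one has modulus at least 2. *)
Lemma flow_ge3 r N : vertex G -> has_flow r N -> 3 <= r.
Proof.
move=> v [g [g_bd g_bound _]].
have [e] : exists e, e \in inc v by apply/set0Pn; rewrite -card_gt0 (card_inc G_cubic).
rewrite in_inc => /(inc_split G_cubic) [f [h H]]; have := g_bd v; rewrite (sum_inc _ H).
have bd x : x \in inc v -> 1 <= `|g v x| <= r - 1 by rewrite in_inc; apply: g_bound.
case: H => _ _ _ Ei.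
have := bd e; have := bd f; have := bd h; rewrite Ei !inE !eqxx ?orbT /=.
move=> /(_ isT) bh /(_ isT) bf /(_ isT) be; move: bh bf be; rewrite !ler_norml !ler_normr.
by case/andP=> /orP[?|?] /andP[? ?]; case/andP=> /orP[?|?] /andP[? ?]; case/andP=> /orP[?|?] /andP[? ?] ?; lra.
Qed.

(** The common truth value is the sign of the number of largest modulus: a number of
    modulus at least 2 has that sign, the other two have the opposite one. *)
Lemma small_zero_sum (x y z : R) : x + y + z = 0 ->
    1 <= `|x| < 3 -> 1 <= `|y| < 3 -> 1 <= `|z| < 3 ->
  ((2 <= `|x|) == (0 < x)) = ((2 <= `|y|) == (0 < y)).
Proof.
have pos (t : R) : 1 <= `|t| < 3 ->
    [/\ 1 <= t, t < 3, `|t| = t & (0 < t) = true] \/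
    [/\ t <= -1, -3 < t, `|t| = - t & (0 < t) = false].
  by case: (ltrgt0P t) => t0 /andP[t1 t3]; [left|right|exfalso]; try split=> //; lra.
move=> xyz /pos bx /pos b_y /pos bz.
case: bx b_y => [[x1 x3 -> ->]|[x1 x3 -> ->]] [[y1 y3 -> ->]|[y1 y3 -> ->]];
case: bz => [[z1 z3 _ _]|[z1 z3 _ _]]; clear pos;
by case: (leP (2 : R)) => ?; case: (leP (2 : R)) => ? //=; exfalso; lra.
Qed.

(** Below 4, each vertex carries one value of modulus at least 2 and two values of
    modulus less than 2 of the opposite sign; the sign of the large value
    splits the vertices into two sides. *)
Lemma small_flow_cut r N : r < 4 -> has_flow r N -> exists A, N = ~: cutset A.
Proof.
move=> r4 [g [g_bd g_bound g_opp]].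
have bd v e : v \in ends e -> 1 <= `|g v e| < 3.
  by move=> ve; have /andP[-> /= H] := g_bound v e ve; apply: le_lt_trans H _; lra.
pose side v e := (2 <= `|g v e|) == (0 < g v e).
have sideE v e f : v \in ends e -> v \in ends f -> side v e = side v f.
  move=> ve vf; have [e1 [e2 H]] := inc_split G_cubic ve.
  have := g_bd v; rewrite (sum_inc _ H); case: H => _ _ _ Ei S.
  have := bd v; have : f \in inc v by rewrite in_inc.
  have e1v : v \in ends e1 by rewrite -in_inc Ei !inE eqxx orbT.
  have e2v : v \in ends e2 by rewrite -in_inc Ei !inE eqxx orbT.
  move=> + b; rewrite Ei !inE => /orP[/orP[]|] /eqP-> //.
    by apply: small_zero_sum S _ _ _; apply: b.
  by apply: (@small_zero_sum _ _ (g v e1)); rewrite 1?addrAC //; apply: b.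
pose A := [set v | [exists e in inc v, side v e]].
have AE v e : v \in ends e -> (v \in A) = side v e.
  move=> ve; rewrite inE; apply/existsP/idP => [[f /andP[]]|s]; last by exists e; rewrite in_inc ve.
  by rewrite in_inc => vf; rewrite (sideE v f e).
exists A; apply/setP => e; rewrite inE; have [v ve] := end_exists e.
rewrite (in_cutset _ ve) negbK (AE v e) // (AE _ e) ?opp_in // /side.
rewrite g_opp //; case: ifP => eN; first by rewrite eqxx.
rewrite normrN oppr_gt0; have /andP[g1 _] := bd v e ve.
have : g v e != 0 by rewrite -normr_gt0; apply: lt_le_trans g1.
by case: (2 <= _); case: ltgtP.
Qed.

(** Send 2 through the edges of the 1-factor and 1 through the others, leaving the
    vertices of [A] along [M] and entering them along the other edges, and the other
    way round at the remaining vertices. *)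
Lemma cut_flow M A : is_factor 1 M -> has_flow (3 : R) (~: cutset A).
Proof.
move=> /factorP M1; pose b v : R := if v \in A then 1 else -1.
exists (fun v e => b v * (if e \in M then 2 else -1)); split=> [v|v e ve|v e ve].
- rewrite -big_distrr /= (bigID (mem M)) /=.
  rewrite (eq_bigr (fun=> 2)) => [|e /andP[_ ->//]].
  rewrite [X in _ + X](eq_bigr (fun=> -1)) => [|e /andP[_ /negbTE->//]].
  rewrite !sumr_const.
  have -> : #|[pred e in inc v | e \in M]| = 1%N.
    by rewrite -(M1 v); apply: eq_card => e; rewrite !inE andbC.
  suff -> : #|[pred e in inc v | e \notin M]| = 2%N by rewrite mulr1n mulr2n; lra.
  have := card_inc G_cubic v; rewrite -(cardsID M (inc v)) setIC M1 add1n => -[<-].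
  by apply: eq_card => e; rewrite !inE andbC.
- rewrite normrM; have -> : `|b v| = 1 by rewrite /b; case: ifP; rewrite ?normrN normr1.
  by rewrite mul1r; case: ifP => _; rewrite ?normrN ?normr1 ?ger0_norm //; apply/andP; split; lra.
- rewrite inE (in_cutset _ ve) negbK /b; case: (v \in A); case: (opp e v \in A) => //=;
  by rewrite ?(mul1r, mulN1r, opprK).
Qed.

End CubicFlows.

(** * Sets with circular flow number 3 or 4 *)

Section FlowNumber.
Local Open Scope ring_scope.
Variables (R : realType) (G : multigraph).
Implicit Types (N M X : {set edge G}) (A : {set vertex G}) (g : vertex G -> edge G -> R).
Implicit Types (e : edge G) (v : vertex G) (r s : R).

Local Notation n := #|{: vertex G * edge G}|.
Let at_half (y : 'rV[R]_n) v e : R := y 0 (enum_rank (v, e)).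

(** Flows for bounds tending to [r] accumulate at a point of a compact box, and the
    conditions on a flow are closed. The flows are first made 0 outside the
    half-edges, so that they lie in the box. *)
Lemma has_flow_closed r N : (forall s, r < s -> has_flow s N) -> has_flow r N.
Proof.
move=> Nr.
pose K s : set 'rV[R]_n :=
  [set y | flow s N (at_half y) /\ forall i, - `|r| <= y 0 i <= `|r|]%classic.
(* [F] is generated by the nonempty sets [K s], which decrease with [s]. *)
pose F := filter_from [set s | r < s <= r + 1]%classic K.
have K0 s : r < s <= r + 1 -> (K s !=set0)%classic.
  move=> /andP[rs s1]; have [g [g_bd g_bound g_opp]] := Nr s rs.
  pose g' v e := if v \in ends e then g v e else 0.
  exists (\row_i g' (enum_val i).1 (enum_val i).2).
  have E v e : at_half (\row_i g' (enum_val i).1 (enum_val i).2) v e = g' v e.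
    by rewrite /at_half mxE enum_rankK.
  split.
    split=> [v|v e ve|v e ve]; rewrite ?E /g' ?ve ?opp_in //; last first.
    - exact: g_opp.
    - exact: g_bound.
    - by rewrite -[RHS](g_bd v); apply: eq_bigr => e; rewrite E /g' in_inc => ->.
  move=> i; rewrite mxE -ler_norml /g'; case: ifP => [ve|_]; last by rewrite normr0.
  have /andP[_ H] := g_bound _ _ ve; apply: le_trans H (le_trans _ (ler_norm r)); lra.
have F_filter : ProperFilter F.
  apply: filter_from_proper; last exact: K0.
  apply: filter_from_filter; first by exists (r + 1) => /=; apply/andP; split; lra.
  move=> s t /= /andP[rs s1] /andP[rt t1]; exists (Num.min s t).
    by rewrite /= lt_min rs rt /= ge_min s1.
  have le_K u w : u <= w -> (K u `<=` K w)%classic.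
    move=> uw y [[y1 y2 y3] yb]; split=> //; split=> // v e /y2 /andP[-> /= H].
    by apply: le_trans H _; rewrite lerD2r.
  by move=> y Ky; split; apply: le_K Ky; rewrite ge_min lexx ?orbT.
have box_compact : compact [set y : 'rV[R]_n | forall i, y ord0 i \in `[- `|r|, `|r|]%R]%classic.
  by apply: (@rV_compact _ _ (fun=> `[- `|r|, `|r|]%classic)) => i; apply: segment_compact.
have [|p [_ p_cl]] := box_compact F F_filter.
  exists (r + 1) => [|y [_ yb] i]; first by rewrite /=; apply/andP; split; lra.
  by rewrite /= in_itv; apply: yb.
have near s (d : R) : r < s -> 0 < d ->
    exists y, flow s N (at_half y) /\ forall v e, `|at_half p v e - at_half y v e| < d.
  move=> rs d0; have [] := p_cl (K (Num.min s (r + 1))) (ball p d).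
  - exists (Num.min s (r + 1)) => //=; rewrite lt_min rs /= ge_min lexx orbT andbT; lra.
  - exact: nbhsx_ballx.
  - move=> y [[[y1 y2 y3] _] [_ yp]]; exists y; split; last by move=> v e; apply: yp.
    split=> // v e /y2 /andP[-> /= H]; apply: le_trans H _.
    by rewrite lerD2r ge_min lexx.
have small (x c : R) : 0 <= c -> (forall d, 0 < d -> `|x| <= c * d) -> x = 0.
  move=> c0 H; apply/eqP/negPn/negP; rewrite -normr_gt0 => x0.
  have c1 : 0 < c + 1 by lra.
  have := H (`|x| / (c + 1)) (divr_gt0 x0 c1).
  rewrite mulrA ler_pdivlMr // mulrC; nra.
have r1 : r < r + 1 by lra.
exists (at_half p); split=> [v|v e ve|v e ve].
- apply: (small _ #|inc v|%:R) => [|d d0]; first exact: ler0n.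
  have [y [[y1 _ _] yp]] := near (r + 1) d r1 d0.
  have -> : \sum_(e in inc v) at_half p v e = \sum_(e in inc v) (at_half p v e - at_half y v e).
    by rewrite sumrB y1 subr0.
  apply: le_trans (ler_norm_sum _ _ _) _; rewrite mulr_natl -sumr_const.
  by apply: ler_sum => e _; apply/ltW/yp.
- have H d : 0 < d -> 1 - d <= `|at_half p v e| <= r - 1 + d.
    move=> d0; have rd : r < r + d / 2 by lra.
    have d2 : 0 < d / 2 by lra.
    have [y [[_ y2 _] yp]] := near (r + d / 2) (d / 2) rd d2.
    have /andP[] := y2 v e ve; have := yp v e.
    have := ler_dist_dist (at_half p v e) (at_half y v e).
    move=> dd yd y_ge1 y_le; have := le_lt_trans dd yd; rewrite ltr_norml => /andP[? ?].
    by apply/andP; split; lra.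
  apply/andP; split; rewrite leNgt; apply/negP => lt.
    have d0 : 0 < (1 - `|at_half p v e|) / 2 by lra.
    by have /andP[] := H _ d0; lra.
  have d0 : 0 < (`|at_half p v e| - (r - 1)) / 2 by lra.
  by have /andP[] := H _ d0; lra.
- apply/eqP; rewrite -subr_eq0; apply/eqP; apply: (small _ 2) => // d d0.
  have [y [[_ _ y3] yp]] := near (r + 1) d r1 d0.
  have := yp v e; have := yp (opp e v) e; rewrite y3 //; case: ifP => _;
  rewrite !ltr_norml ler_norml => /andP[? ?] /andP[? ?]; apply/andP; split; lra.
Qed.


(** The complements of cuts; on a cubic graph with a 1-factor these are the
    sets of negative edges with circular flow number 3. *)
Definition cocut N : Prop := exists A : {set vertex G}, N = ~: cutset A.

Definition signature_of N e : int := if e \in N then -1 else 1.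

Lemma signature_ofP N : is_signature (signature_of N).
Proof. by move=> e; rewrite /signature_of; case: ifP; [right|left]. Qed.

Lemma negative_signature_of N : negative_edges (signature_of N) = N.
Proof. by apply/setP => e; rewrite inE /signature_of; case: ifP. Qed.

Section Cubic.
Hypothesis G_cubic : cubic G.
Variable M : {set edge G}.
Hypothesis M_factor : is_factor 1 M.
Variable v0 : vertex G.

Lemma cfn3P (sigma : edge G -> int) : is_signature sigma ->
  circular_flow_number R sigma = 3%:E <-> cocut (negative_edges sigma).
Proof.
move=> sig; split=> [E|[A EA]].
  (* Any bound strictly between 3 and 4 will do. *)
  apply: (small_flow_cut (R := R) G_cubic (r := 7 / 2)); first lra.
  by apply: cfn_approx sig E _; lra.
apply: cfn_eq => //; first lra.
  by rewrite EA; apply: cut_flow M_factor.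
by move=> s; apply: flow_ge3 v0.
Qed.

Lemma cfn4P (sigma : edge G -> int) : is_signature sigma ->
  circular_flow_number R sigma = 4%:E <->
  has_flow (4 : R) (negative_edges sigma) /\ ~ cocut (negative_edges sigma).
Proof.
move=> sig; split=> [E|[f4 ncut]].
  split; first by apply: has_flow_closed => s; apply: cfn_approx sig E.
  by move/(cfn3P sig); rewrite E => -[]; lra.
apply: cfn_eq => //; first lra.
by move=> s fs; rewrite leNgt; apply/negP => /(small_flow_cut G_cubic)/(_ fs).
Qed.

End Cubic.

Section Minimal.
Variables (r : R) (P : {set edge G} -> Prop).
Hypothesis cfnP : forall sigma : edge G -> int, is_signature sigma ->
  circular_flow_number R sigma = r%:E <-> P (negative_edges sigma).

Lemma is_minimalP X : is_minimal r X <-> P X /\ forall N, N \proper X -> ~ P N.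
Proof.
split=> [[[sigma [sig <- E]] Xmin]|[PX Xmin]].
  split=> [|N NX PN]; first exact/cfnP.
  apply: (Xmin (signature_of N)); rewrite ?negative_signature_of //.
    exact: signature_ofP.
  by apply/cfnP; rewrite ?negative_signature_of //; exact: signature_ofP.
split=> [|sigma sig /Xmin nP /(cfnP sig)//].
exists (signature_of X); rewrite negative_signature_of; split=> //.
  exact: signature_ofP.
by apply/cfnP; rewrite ?negative_signature_of //; exact: signature_ofP.
Qed.

(** A set with flow number [r] contains an [r]-minimal one. *)
Lemma is_smallest_minimalP X :
  is_smallest_minimal r X <-> P X /\ forall N, P N -> (#|X| <= #|N|)%N.
Proof.
split=> [[/is_minimalP[PX _] Xmin]|[PX Xmin]]; last first.
  split=> [|N /is_minimalP[PN _]]; last exact: Xmin.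
  by apply/is_minimalP; split=> // N /proper_card NX /Xmin; rewrite leqNgt NX.
split=> // N; have [m] := ubnP #|N|; elim: m N => // m IHm N Nm PN.
have [[N' [N'N PN']]|no] := pselect (exists N', N' \proper N /\ P N').
  have lt := proper_card N'N.
  exact: leq_trans (IHm N' (leq_trans lt Nm) PN') (ltnW lt).
by apply: Xmin; apply/is_minimalP; split=> // N' N'N PN'; apply: no; exists N'.
Qed.

Lemma smallest_minimal_exists N : P N -> exists X, is_smallest_minimal r X.
Proof.
move=> PN; have [|X /asboolP PX Xmin] := @arg_minnP _ N (fun X => `[<P X>]) (fun X => #|X|).
  exact/asboolP.
by exists X; apply/is_smallest_minimalP; split=> // N' /asboolP/Xmin.
Qed.

End Minimal.
End FlowNumber.

Section CutBounds.
Variable G : multigraph.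
Hypothesis G_cubic : cubic G.
Implicit Types (N M X : {set edge G}) (A S : {set vertex G}).
Implicit Types (e f : edge G) (v : vertex G).

Lemma cocut_all : cocut [set: edge G].
Proof.
exists finset.set0; apply/setP => e; rewrite !inE.
by have [v ve] := end_exists e; rewrite setI0 cards0.
Qed.

Lemma cocut0 : bipartite G -> cocut (finset.set0 : {set edge G}).
Proof.
case/existsP => A /forallP A1; exists A; apply/setP => e.
by rewrite !inE A1.
Qed.

Lemma cocut0_bipartite : cocut (finset.set0 : {set edge G}) -> bipartite G.
Proof.
case=> A EA; apply/existsP; exists A; apply/forallP => e.
by have := in_set0 e; rewrite EA !inE => /negbFE.
Qed.

Section Smallest.
Variable X : {set edge G}.
Hypotheses (X_cocut : cocut X) (X_min : forall N, cocut N -> #|X| <= #|N|).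

Lemma independent_cut S : independent S -> #|cutset S| = 3 * #|S|.
Proof.
move=> /forallP Sind.
have := double_count [set: edge G] S.
rewrite (eq_bigr (fun=> 3)); last by move=> v _; rewrite setTI (card_inc G_cubic).
rewrite sum_nat_const mulnC => ->.
rewrite (eq_bigl xpredT) => [|e]; last by rewrite inE.
rewrite -sum1_card big_mkcond /=; apply: eq_bigr => e _; rewrite inE.
have := Sind e; have := card_ends2 e => e2 /negP eS.
have : #|ends e :&: S| <= 2 by rewrite -e2 subset_leq_card ?subsetIl.
have : #|ends e :&: S| != 2.
  apply/eqP => E; apply: eS; apply/setIidPl/eqP.
  by rewrite eqEcard subsetIl E e2.
by case: #|_| => [|[|[]]].
Qed.

Lemma smallest_cocut_alpha : #|X| + 3 * independence_number G <= #|edge G|.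
Proof.
rewrite /independence_number.
have [S Sind ->] : exists2 S : {set vertex G}, independent S & 
    \max_(S : {set vertex G} | independent S) #|S| = #|S|.
  case: (@eq_bigmax_cond _ [pred S : {set vertex G} | independent S] (fun S => #|S|)) => [|S Sind E].
    apply/card_gt0P; exists finset.set0; apply/forallP => e; apply/negP => /subset_leq_card.
    by rewrite card_ends2 cards0.
  by exists S.
rewrite -independent_cut // -(cardsC (cutset S)) addnC leq_add2l.
by apply: X_min; exists S.
Qed.

(** Moving one vertex to the other side exchanges the cut edges and the other
    edges at that vertex. *)
Lemma smallest_cocut_matching v : #|X :&: inc v| <= 1.
Proof.
have [A EA] := X_cocut.
have := X_min (ex_intro (fun B => ~: cutset (sdiff A [set v]) = ~: cutset B) _ erefl).
have -> : ~: cutset (sdiff A [set v]) = (X :\: inc v) :|: (inc v :\: X).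
  apply/setP => e; rewrite EA !in_setC in_cutset_sdiff cutset1 !in_setU !in_setD in_setC.
  by case: (_ \in cutset _); case: (_ \in inc _).
rewrite cardsU (_ : _ :&: _ = finset.set0) ?cards0 ?subn0; last first.
  by apply/setP => e; rewrite !inE; do 2!case: (_ \in _).
have := card_inc G_cubic v; have := cardsID (inc v) X; have := cardsID X (inc v).
by rewrite [inc v :&: X]setIC; lia.
Qed.

Lemma smallest_cocut_half : 2 * #|X| <= #|vertex G|.
Proof.
rewrite -double_countT -sum1_card; apply: leq_sum => v _; exact: smallest_cocut_matching.
Qed.

End Smallest.
End CutBounds.

(** * Flows with values up to 3 from half-edge colourings *)

Section HalfColoringFlow.
Local Open Scope ring_scope.
Variables (R : realType) (G : multigraph).
Hypothesis G_cubic : cubic G.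
Implicit Types (N F : {set edge G}) (e f h : edge G) (u v w : vertex G).

Definition sgb (b : bool) : R := if b then 1 else -1.

Lemma sgbN b : sgb (~~ b) = - sgb b.
Proof. by case: b; rewrite /= ?opprK. Qed.

Lemma sum_sgb (T : finType) (S : {set T}) (c : T -> bool) : #|S| = 2 ->
    (forall x y, x \in S -> y \in S -> x != y -> c y = ~~ c x) ->
  \sum_(x in S) sgb (c x) = 0.
Proof.
move=> /eqP/cards2P[x [y [xy ->]]] cP.
rewrite big_setU1 ?big_set1 ?inE //= (cP x y) ?inE ?eqxx ?orbT //.
by rewrite sgbN subrr.
Qed.

(** Give the edges outside [F] colour 1 and the half-edges of [F] colour 2 or 3
    according to [d]. The half-edges of colours 1 and 2, and those of colours 2
    and 3, form paths and circuits; orient them by [s12] and [s23]. The flow is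
    twice the first circulation plus or minus the second, with a sign [eps] for
    each circuit of [F]. An edge of [N] has colour 2 at one end, where its value is
    a sum of 2 and 1 up to signs, and colour 3 at the other, where it is 1 up to
    sign. It becomes a negative edge of value 1 when [eps] makes the 2 and the 1 at
    the first end cancel partly; this can be arranged when no circuit of [F]
    contains two edges of [N], which is what the last hypothesis is for. *)
Lemma half_coloring_flow F N (d : vertex G -> edge G -> bool) :
    is_factor 2 F ->
    (forall v e f, e \in F -> f \in F -> v \in ends e -> v \in ends f -> e != f ->
       d v f = ~~ d v e) ->
    N \subset F ->
    (forall v e, e \in F -> v \in ends e -> (e \in N) = (d (opp e v) e != d v e)) ->
    (forall t : edge G -> bool, exists eps : edge G -> bool,
       (forall v e f, e \in F -> f \in F -> v \in ends e -> v \in ends f -> eps e = eps f) /\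
       (forall e, e \in N -> eps e = t e)) ->
  has_flow (4 : R) N.
Proof.
move=> /factorP F2 d_alt NF d_N choose_eps.
pose D v := [set e in inc v | (e \notin F) || d v e].
have D_inc v : D v \subset inc v by apply/fintype.subsetP => e; rewrite inE => /andP[].
have D2 v : #|D v| = 2.
  have /eqP/cards2P[f [h [fh Ev]]] := F2 v.
  have /setIP[fF] : f \in F :&: inc v by rewrite Ev !inE eqxx.
  have /setIP[hF] : h \in F :&: inc v by rewrite Ev !inE eqxx orbT.
  rewrite !in_inc => vh vf; have dfh := d_alt v f h fF hF vf vh fh.
  have -> : D v = (if d v f then f else h) |: (inc v :\: F).
    apply/setP => e; rewrite !inE; case: (boolP (e \in F)) => eF /=; last first.
      rewrite andbT; case: eqP => // E; move: eF; rewrite E; by case: ifP; rewrite ?fF ?hF.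
    rewrite orbF; have : (e \in F :&: inc v) = (e \in [set f; h]) by rewrite Ev.
    rewrite !inE eF /= => ->; case: (eqVneq e f) => [->|ef] /=.
      by case: ifP => //; rewrite ?eqxx // (negbTE fh).
    case: (eqVneq e h) => [->|eh] /=; first by rewrite dfh; case: ifP; rewrite ?eqxx // eq_sym (negbTE fh).
    by case: ifP; rewrite ?(negbTE ef) ?(negbTE eh).
  rewrite cardsU1 !inE; have -> : (if d v f then f else h) \in F by case: ifP.
  have := card_inc G_cubic v; rewrite -(cardsID F (inc v)) setIC F2 add2n => -[->].
  by [].
have [s12 [s12_v s12_e]] := half_edge_signs D_inc (fun v => eq_leq (D2 v)).
have [s23 [s23_v s23_e]] :=
  half_edge_signs (fun v => subsetIr F (inc v)) (fun v => eq_leq (F2 v)).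
pose t e := [exists u in ends e, d u e && (~~ s12 u e (+) s23 u e)].
have [eps [eps_v eps_N]] := choose_eps t.
have s23F v e : e \in F -> v \in ends e -> s23 (opp e v) e = ~~ s23 v e.
  by move=> eF ve; apply: s23_e; rewrite in_setI eF in_inc ?opp_in.
pose g v e := (if e \in D v then 2 * sgb (s12 v e) else 0) +
              (if e \in F then sgb (eps e (+) s23 v e) else 0).
(* The value at the end of colour 2 is 2 - 1 up to sign, by the choice of [t]. *)
have g_broken v e : e \in N -> v \in ends e -> d v e ->
    g v e = sgb (s12 v e) /\ g (opp e v) e = sgb (s12 v e).
  move=> eN ve dve; have eF := fintype.subsetP NF e eN.
  have := d_N v e eF ve; rewrite eN dve => /esym; case dov: (d (opp e v) e) => // _.
  have epsE : eps e = ~~ s12 v e (+) s23 v e.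
    rewrite eps_N //; apply/existsP/idP => [[u /and3P[ue]]|H]; last by exists v; rewrite ve dve.
    by have [->//|->] := ends_cases ue ve; rewrite dov.
  rewrite /g !inE ve opp_in // eF dve dov /= s23F // epsE.
  by case: (s12 v e); case: (s23 v e); rewrite /= /sgb; split; lra.
exists g; split=> [v|v e ve|v e ve].
- rewrite big_split /=.
  have -> : \sum_(e in inc v) (if e \in D v then 2 * sgb (s12 v e) else 0) =
            2 * \sum_(e in D v) sgb (s12 v e).
    rewrite big_distrr /= -big_mkcondr /=; apply: eq_bigl => e.
    by rewrite !inE andbA andbb.
  rewrite (sum_sgb (D2 v)); last by move=> x y xD yD; apply: s12_v.
  rewrite -big_mkcondr /= (eq_bigl (mem (F :&: inc v))) => [|e]; last by rewrite !inE andbC.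
  rewrite (sum_sgb (F2 v)) => [|x y xF yF xy]; first by rewrite mulr0 addr0.
  rewrite (s23_v v x y) //; case/setIP: xF; case/setIP: yF; rewrite !in_inc => yF vy xF vx.
  by rewrite (eps_v v y x) // addbN.
- have sgb_cases b : sgb b = 1 \/ sgb b = -1 by case: b; [left|right].
  have := g_broken; rewrite /g !inE ve /=.
  case: (boolP (e \in F)) => eF /= _; last first.
    rewrite addr0; have [->|->] := sgb_cases (s12 v e); rewrite ?mulrN1 ?mulr1 ?normrN ger0_norm //;
    by apply/andP; split; lra.
  clear; rewrite /sgb; case: (d v e); case: (s12 v e); case: (eps e (+) s23 v e);
  (apply/andP; split; last by rewrite ler_norml; apply/andP; split; lra);
  by rewrite ler_normr; apply/orP; first [by left; lra | by right; lra].
- case: ifP => [eN|/negbT eN].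
    have eF := fintype.subsetP NF e eN.
    case dve: (d v e); first by have [-> ->] := g_broken v e eN ve dve.
    have := d_N v e eF ve; rewrite eN dve; case dov: (d (opp e v) e) => // _.
    by have := g_broken _ _ eN (opp_in ve) dov; rewrite oppK => -[-> ->].
  have Dv : (e \in D (opp e v)) = (e \in D v).
    rewrite !inE opp_in // ve /=; case: (boolP (e \in F)) => //= eF.
    by have := d_N v e eF ve; rewrite (negbTE eN) => /esym/negbFE/eqP.
  rewrite /g Dv opprD; congr (_ + _).
    case: ifP => [eD|_]; last by rewrite oppr0.
    by rewrite s12_e ?Dv // sgbN mulrN.
  case: ifP => [eF|_]; last by rewrite oppr0.
  by rewrite s23F // addbN sgbN.
Qed.

End HalfColoringFlow.

(** * The circuits of a 2-factor *)

Lemma findex_step (T : finType) (f : T -> T) (x y : T) : injective f -> fconnect f x y ->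
  if f y == x then (findex f x y).+1 = order f x else findex f x (f y) = (findex f x y).+1.
Proof.
move=> f_inj xy; have := findex_max xy; have := iter_findex xy.
set k := findex f x y => Ek; rewrite leq_eqVlt => /orP[/eqP k1|k1].
  by rewrite -Ek -iterS k1 iter_order // eqxx.
have fy : findex f x (f y) = k.+1 by rewrite -(findex_iter k1) iterS Ek.
by case: eqP => // E; move: fy; rewrite E findex0.
Qed.

Section Circuits.
Variable G : multigraph.
Implicit Types (C : {set edge G}) (e f : edge G) (u v w : vertex G).
Variables (F : {set edge G}) (s : vertex G -> edge G -> bool).
Hypotheses (F_factor : is_factor 2 F)
  (s_v : forall v e f, e \in F :&: inc v -> f \in F :&: inc v -> e != f -> s v f = ~~ s v e)
  (s_e : forall v e, e \in F :&: inc v -> e \in F :&: inc (opp e v) ->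
     s (opp e v) e = ~~ s v e).

Let F2 v : #|F :&: inc v| = 2.
Proof. by have /factorP := F_factor. Qed.

Let inF v e : (e \in F :&: inc v) = (e \in F) && (v \in ends e).
Proof. by rewrite !inE. Qed.

(** The signs [s] orient each circuit of [F]; an edge of [F] points to its end with
    sign [true], and [next e] is the edge of [F] that leaves this end. *)
Definition next e :=
  if [pick v in ends e | s v e] is Some v then mate (F :&: inc v) e else e.

Lemma sign_opp v e : e \in F -> v \in ends e -> s (opp e v) e = ~~ s v e.
Proof. by move=> eF ve; apply: s_e; rewrite inF eF ?opp_in. Qed.

Lemma head_exists e : e \in F -> exists2 v, v \in ends e & s v e.
Proof.
move=> eF; have [v ve] := end_exists e; case sve: (s v e); first by exists v.
by exists (opp e v); rewrite ?opp_in ?sign_opp ?sve.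
Qed.

Lemma next_at v e : e \in F -> v \in ends e -> s v e -> next e = mate (F :&: inc v) e.
Proof.
move=> eF ve sve; rewrite /next; case: pickP => [u /andP[ue su]|/(_ v)]; last by rewrite ve sve.
by have [->//|E] := ends_cases ue ve; move: su; rewrite E sign_opp ?sve.
Qed.

Lemma next_out e : e \notin F -> next e = e.
Proof.
move=> eF; rewrite /next; case: pickP => // v _.
by rewrite mate_id // inF (negbTE eF).
Qed.

Lemma next_step v e f : e \in F -> f \in F -> v \in ends e -> v \in ends f ->
  e != f -> s v e -> next e = f.
Proof.
move=> eF fF ve vf ef sve; rewrite (next_at eF ve sve).
by apply: mateE; rewrite ?F2 ?inF ?eF ?fF.
Qed.

Lemma next_spec e : e \in F ->
  exists v, [/\ next e \in F, v \in ends e, v \in ends (next e), s v e & s v (next e) = false].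
Proof.
move=> eF; have [v ve sve] := head_exists eF.
have eFv : e \in F :&: inc v by rewrite inF eF.
have := mate_in eFv; rewrite -next_at // => nFv; exists v.
have /andP[nF vn] : (next e \in F) && (v \in ends (next e)) by rewrite -inF.
split=> //; rewrite (s_v eFv nFv) ?sve // eq_sym (next_at eF ve sve).
by apply: mate_neq; rewrite ?F2.
Qed.

Lemma next_inj : injective next.
Proof.
move=> e f; case: (boolP (e \in F)) => eF; case: (boolP (f \in F)) => fF.
- move=> E; have [v [nF ve vn sve svn]] := next_spec eF.
  have [w [_ wf wn swf swn]] := next_spec fF; rewrite -E in wn swn.
  have [wv|wv] := ends_cases wn vn; last by move: swn; rewrite wv sign_opp ?svn.
  move: E; rewrite (next_at eF ve sve) (next_at fF wf swf) wv.
  by apply: (can_inj (mateK _)); rewrite F2.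
- by rewrite (next_out fF) => E; have [? []] := next_spec eF; rewrite E (negbTE fF).
- by rewrite (next_out eF) => E; have [? []] := next_spec fF; rewrite -E (negbTE eF).
- by rewrite !next_out.
Qed.

Let next_sym := fconnect_sym next_inj.

Definition circ e : {set edge G} := [set f | fconnect next e f].

Lemma circ_refl e : e \in circ e.
Proof. by rewrite inE. Qed.

Lemma eq_circ e f : fconnect next e f -> circ e = circ f.
Proof.
move=> ef; apply/setP => h; rewrite !inE; apply/idP/idP => H; last exact: connect_trans H.
by apply: connect_trans H; rewrite next_sym.
Qed.

Lemma meet_connect v e f : e \in F -> f \in F -> v \in ends e -> v \in ends f ->
  fconnect next e f.
Proof.
move=> eF fF ve vf; case: (eqVneq e f) => [->//|ef].
case sve: (s v e); first by rewrite -(next_step eF fF ve vf ef sve) fconnect1.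
rewrite next_sym -(@next_step v f e) ?fconnect1 // 1?eq_sym //.
by rewrite (@s_v v e f) ?inF ?eF ?fF // sve.
Qed.

Lemma circ_sub e : e \in F -> circ e \subset F.
Proof.
move=> eF; apply/fintype.subsetP => f; rewrite inE => /iter_findex <-.
by elim: findex => //= n IHn; have [? []] := next_spec IHn.
Qed.

Lemma circ_inc e v f : e \in F -> f \in circ e -> v \in ends f -> circ e :&: inc v = F :&: inc v.
Proof.
move=> eF fC vf; have fF := fintype.subsetP (circ_sub eF) f fC.
apply/setP => h; rewrite !inE; case: (boolP (v \in ends h)) => vh; rewrite ?andbF ?andbT //.
apply/idP/idP => [H|hF]; first by apply: (fintype.subsetP (circ_sub eF)); rewrite inE.
by rewrite inE in fC; apply: connect_trans fC _; apply: meet_connect vh.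
Qed.

Lemma circ_circuit e : e \in F -> is_circuit (circ e).
Proof.
move=> eF; apply/and3P; split.
- by apply/set0Pn; exists e; apply: circ_refl.
- apply/forallP => v; have -> : [set f in circ e | v \in ends f] = circ e :&: inc v.
    by apply/setP => f; rewrite !inE.
  have [-> |[f /setIP[fC]]] := set_0Vmem (circ e :&: inc v); first by rewrite cards0.
  by rewrite in_inc => vf; rewrite (circ_inc eF fC vf) F2.
- have adjC f u w : f \in circ e -> u \in ends f -> w \in ends f -> connect (adj (circ e)) u w.
    move=> fC uf wf; have [->//|->] := ends_cases wf uf.
    by apply: connect1; apply/existsP; exists f; rewrite fC -(ends_opp uf) eqxx.
  apply/forallP => f; apply/implyP => fC; apply/forallP => h; apply/implyP => hC.
  apply/forallP => u; apply/implyP => uf; apply/forallP => w; apply/implyP => wh.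
  have : fconnect next f h.
    by move: fC hC; rewrite !inE next_sym => fe eh; apply: connect_trans eh.
  move=> /iter_findex E; rewrite -E in wh hC; elim: (findex _ _ _) w wh hC {E} => [|n IHn] w /= wh hC.
    exact: adjC fC uf wh.
  have nC : iter n next f \in circ e.
    by move: fC; rewrite !inE => fC; apply: connect_trans fC (fconnect_iter _ _ _).
  have [x [_ xn xn' _ _]] := next_spec (fintype.subsetP (circ_sub eF) _ nC).
  exact: connect_trans (IHn x xn nC) (adjC _ _ _ hC xn' wh).
Qed.

Lemma circuit_degree C v : is_circuit C -> #|C :&: inc v| \in [:: 0; 2].
Proof.
case/and3P => _ /forallP/(_ v) + _; have -> // : [set f in C | v \in ends f] = C :&: inc v.
by apply/setP => f; rewrite !inE.
Qed.

Lemma circuit_inc C v e : is_circuit C -> C \subset F -> e \in C -> v \in ends e ->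
  C :&: inc v = F :&: inc v.
Proof.
move=> C_circ CF eC ve; apply/eqP; rewrite eqEcard setSI //= F2.
have := circuit_degree v C_circ; rewrite !inE => /orP[|/eqP->//].
by rewrite cards_eq0 => /eqP/setP/(_ e); rewrite !inE eC ve.
Qed.

(** At a vertex of [C] both edges of [F] belong to [C], so [C] is closed under [next],
    and as it is connected it is a single orbit. *)
Lemma circuit_circ C e : is_circuit C -> C \subset F -> e \in C -> C = circ e.
Proof.
move=> C_circ CF eC; have eF := fintype.subsetP CF e eC.
apply/eqP; rewrite eqEsubset; apply/andP; split; apply/fintype.subsetP => f.
  move=> fC; have /and3P[_ _ /forallP/(_ e)] := C_circ; rewrite eC => /forallP/(_ f); rewrite fC.
  have [u ue] := end_exists e; have [w wf] := end_exists f.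
  move=> /forallP/(_ u); rewrite ue => /forallP/(_ w); rewrite wf => /connectP[p].
  have : forall h, h \in F -> u \in ends h -> h \in circ e.
    by move=> h hF uh; rewrite inE; apply: meet_connect uh.
  elim: p u {ue} => [|x p IHp] u /= Hu; first by move=> _ E; apply: Hu; rewrite -?E // (fintype.subsetP CF).
  case/andP => /existsP[h /andP[hC /eqP Eh]] xp wE.
  apply: (IHp x) => // k kF xk; have hF := fintype.subsetP CF h hC.
  have : h \in circ e by apply: Hu; rewrite // Eh !inE eqxx.
  rewrite !inE => eh; apply: connect_trans eh _; apply: (@meet_connect x) => //.
  by rewrite Eh !inE eqxx orbT.
rewrite inE => /iter_findex <-; elim: findex => //= n IHn.
have [v [nF vn vn' _ _]] := next_spec (fintype.subsetP CF _ IHn).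
have : next (iter n next e) \in F :&: inc v by rewrite inF nF.
by rewrite -(circuit_inc C_circ CF IHn vn) !inE => /andP[].
Qed.

Lemma card_circ e : #|circ e| = order next e.
Proof. by rewrite cardsE. Qed.

Lemma odd_circuitsE : odd_circuits F = #|[set circ e | e in [set e in F | odd #|circ e|]]|.
Proof.
apply: eq_card => C; rewrite inE; apply/and3P/imsetP => [[CF C_circ oC]|[e]].
  have /set0Pn[e eC] : C != finset.set0 by case/and3P: C_circ.
  have E := circuit_circ C_circ CF eC.
  by exists e; rewrite ?E // inE (fintype.subsetP CF) // -E.
by rewrite inE => /andP[eF oe] ->; rewrite circ_sub ?circ_circuit.
Qed.

(** Colouring the circuits alternately from a root on each of them. An odd
    circuit forces a conflict, which is put at the tail of its root. *)
Section Roots.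
Variable root : edge G -> edge G.
Hypothesis root_connect : forall e, fconnect next (root e) e.
Hypothesis root_class : forall e f, fconnect next e f -> root e = root f.

Definition broken : {set edge G} := [set e in F | (root e == e) && odd #|circ e|].

Definition half_color v e : bool :=
  odd (findex next (root e) e) (+) ((e \in broken) && ~~ s v e).

Lemma half_color_alt v e f : e \in F -> f \in F -> v \in ends e -> v \in ends f -> e != f ->
  half_color v f = ~~ half_color v e.
Proof.
wlog sve : e f / s v e.
  move=> H eF fF ve vf ef; case sve: (s v e); first exact: H.
  rewrite (H f e) ?negbK // 1?eq_sym //.
  by rewrite (@s_v v e f) ?inF ?eF ?fF // sve.
move=> eF fF ve vf ef; have svf : s v f = false by rewrite (@s_v v e f) ?inF ?eF ?fF // sve.
have E := next_step eF fF ve vf ef sve.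
rewrite /half_color sve svf andbF addbF andbT.
have <- : root e = root f by apply: root_class; rewrite -E fconnect1.
have := findex_step next_inj (root_connect e); rewrite E; case: eqP => [fr|fr ->]; last first.
  rewrite inE -(@root_class e f) -?E ?fconnect1 // E [root e == f]eq_sym.
  by move/eqP/negbTE: fr => ->; rewrite andbF addbF.
rewrite -fr findex0 /= inE fF -(@root_class e f) -?E ?fconnect1 // E -fr eqxx /=.
by rewrite card_circ => <- /=.
Qed.

Lemma half_color_opp v e : e \in F -> v \in ends e ->
  (e \in broken) = (half_color (opp e v) e != half_color v e).
Proof.
move=> eF ve; rewrite /half_color sign_opp //.
by case: (e \in broken); case: (s v e); case: odd.
Qed.

Lemma card_broken : #|broken| <= odd_circuits F.
Proof.
rewrite odd_circuitsE -(card_in_imset (f := circ)).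
  by apply/subset_leq_card/imsetS/fintype.subsetP => e; rewrite !inE => /and3P[-> _ ->].
move=> e f; rewrite !inE => /and3P[_ /eqP re _] /and3P[_ /eqP rf _] E.
rewrite -re -rf; apply: root_class; have : f \in circ e by rewrite E circ_refl.
by rewrite inE.
Qed.

End Roots.
End Circuits.

(** * Negative edges on the odd circuits *)

Section BrokenCircuits.
Variables (R : realType) (G : multigraph).
Hypothesis G_cubic : cubic G.
Implicit Types (C : {set edge G}) (e f h m : edge G) (u v w : vertex G) (S T W : {set vertex G}).
Variables (F : {set edge G}) (s : vertex G -> edge G -> bool).
Hypotheses (F_factor : is_factor 2 F)
  (s_v : forall v e f, e \in F :&: inc v -> f \in F :&: inc v -> e != f -> s v f = ~~ s v e)
  (s_e : forall v e, e \in F :&: inc v -> e \in F :&: inc (opp e v) ->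
     s (opp e v) e = ~~ s v e).

Local Notation nxt := (next F s).
Local Notation crc := (circ F s).

Lemma matching_edge v : exists2 m, m \notin F & v \in ends m.
Proof.
have := card_inc G_cubic v; rewrite -(cardsID F (inc v)) setIC.
have /factorP -> := F_factor; rewrite add2n => -[H].
have /card_gt0P[m] : 0 < #|inc v :\: F| by rewrite H.
by rewrite !inE => /andP[mF vm]; exists m.
Qed.

Lemma matching_uniq v e f : e \notin F -> f \notin F -> v \in ends e -> v \in ends f -> e = f.
Proof.
move=> eF fF ve vf; have := card_inc G_cubic v; rewrite -(cardsID F (inc v)) setIC.
have /factorP -> := F_factor; rewrite add2n => -[/eqP/cards1P[m Em]].
have : e \in inc v :\: F by rewrite !inE eF.
have : f \in inc v :\: F by rewrite !inE fF.
by rewrite Em !inE => /eqP-> /eqP->.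
Qed.

Section Root.
Variable root : edge G -> edge G.
Hypothesis root_connect : forall e, fconnect nxt (root e) e.
Hypothesis root_class : forall e f, fconnect nxt e f -> root e = root f.

Lemma broken_flow : has_flow (4%R : R) (broken F s root).
Proof.
apply: (half_coloring_flow R G_cubic (d := half_color F s root) F_factor).
- exact: half_color_alt.
- by apply/fintype.subsetP => e; rewrite inE => /andP[].
- by move=> v e; apply: half_color_opp.
move=> t; exists (fun e => t (root e)); split=> [v e f eF fF ve vf|e].
  by rewrite (root_class (meet_connect F_factor s_v s_e eF fF ve vf)).
by rewrite inE => /and3P[_ /eqP->].
Qed.

Lemma unbroken_colorable : broken F s root = finset.set0 -> edge_colorable G 3.
Proof.
move=> nb; pose odd_color e := odd (findex nxt (root e) e).
have alt v e f : e \in F -> f \in F -> v \in ends e -> v \in ends f -> e != f ->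
    odd_color f = ~~ odd_color e.
  move=> eF fF ve vf ef; have := half_color_alt F_factor s_v s_e root_connect root_class eF fF ve vf ef.
  by rewrite /half_color nb !inE !addbF.
pose c e : 'I_3 := if e \in F then if odd_color e then inord 1 else inord 2 else ord0.
apply/existsP; exists [ffun e => c e]; apply/forallP => e; apply/forallP => f.
apply/implyP => /andP[ef /set0Pn[v /setIP[ve vf]]]; rewrite !ffunE /c.
case: (boolP (e \in F)) => eF; case: (boolP (f \in F)) => fF.
- rewrite (alt v e f) //; case: (odd_color e) => /=; by rewrite -val_eqE /= !inordK.
- by case: ifP => _; rewrite -val_eqE /= inordK.
- by case: ifP => _; rewrite -val_eqE /= inordK.
- by rewrite (matching_uniq eF fF ve vf) eqxx in ef.
Qed.

End Root.

(** The default roots, except that the circuit of [e1] is rooted at [e1]. *)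
Definition root_at e1 e := if fconnect nxt e1 e then e1 else froot nxt e.

Let nxt_sym := fconnect_sym (next_inj F_factor s_v s_e).

Lemma root_at_connect e1 e : fconnect nxt (root_at e1 e) e.
Proof. by rewrite /root_at; case: ifP => // _; rewrite nxt_sym connect_root. Qed.

Lemma root_at_class e1 e f : fconnect nxt e f -> root_at e1 e = root_at e1 f.
Proof.
move=> ef; rewrite /root_at (same_connect_r nxt_sym ef); case: ifP => // _.
by apply/eqP; rewrite (root_connect nxt_sym).
Qed.

Lemma in_broken_at e1 e : e1 \in F -> odd #|crc e1| ->
  (e \in broken F s (root_at e1)) =
  if fconnect nxt e1 e then e == e1 else [&& e \in F, froot nxt e == e & odd #|crc e|].
Proof.
move=> e1F o1; rewrite inE /root_at; case: ifP => // e1e.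
case: (eqVneq e1 e) => [<-|ee1]; first by rewrite e1F o1.
by rewrite andbF.
Qed.

(** Suppose that the third edge at every vertex of an odd circuit is a cut, and let
    [S] be a smallest side of such a cut [m]. As [S] has odd size, the 2-factor has
    an odd circuit inside [S], and a vertex of it which is not an end of [m] gives
    another one-edge cut [m'], with both ends in [S]. One of the two parts into
    which [m'] divides [S] is not touched by [m]; it is a smaller side. *)
Lemma odd_circuit_nonbridge e0 : e0 \in F -> odd #|crc e0| ->
  exists v e m, [/\ e \in F, v \in ends e, odd #|crc e| & m \notin F] /\
    (v \in ends m /\ forall W, cutset W <> [set m]).
Proof.
move=> e0F o0; apply: contrapT => none.
have lone v e m : e \in F -> v \in ends e -> odd #|crc e| -> m \notin F -> v \in ends m ->
    exists W, cutset W = [set m].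
  move=> eF ve oe mF vm; apply: contrapT => noW; apply: none.
  by exists v, e, m; do 2!split=> //; move=> W EW; apply: noW; exists W.
pose bad S := [exists m, exists v, exists e,
  [&& e \in F, v \in ends e, odd #|crc e|, m \notin F, v \in ends m & cutset S == [set m]]].
have badP S v e m : e \in F -> v \in ends e -> odd #|crc e| -> m \notin F -> v \in ends m ->
    cutset S = [set m] -> bad S.
  move=> eF ve oe mF vm ES; apply/existsP; exists m; apply/existsP; exists v; apply/existsP; exists e.
  by rewrite eF ve oe mF vm ES eqxx.
have [S0 bad0] : exists S, bad S.
  have [v0 v0e] := end_exists e0; have [m mF vm] := matching_edge v0.
  by have [W EW] := lone _ _ _ e0F v0e o0 mF vm; exists W; exact: (badP W _ _ _ e0F v0e o0 mF vm EW).
have [S badS Smin] := arg_minnP (fun S => #|S|) bad0.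
have /existsP[m /existsP[_ /existsP[_ /and5P[_ _ _ mF /andP[_ /eqP Sm]]]]] := badS.
pose FS := [set e in F | ends e \subset S].
have F_ends e v : e \in F -> v \in ends e -> v \in S -> ends e \subset S.
  move=> eF ve vS; apply/fintype.subsetP => w we; have [->//|->] := ends_cases we ve.
  have : e \notin cutset S by rewrite Sm inE; apply: contraNneq mF => <-.
  by rewrite (in_cutset _ ve) vS negbK => /eqP <-.
have oS : odd #|S| by rewrite -(odd_cut_cubic G_cubic) Sm cards1.
(* [FS] is 2-regular on [S]. *)
have FS_card : #|FS| = #|S|.
  apply/eqP; rewrite -(eqn_pmul2l (m := 2)) //; apply/eqP.
  have := double_count F S; rewrite (eq_bigr (fun=> 2)); last by move=> v _; have /factorP := F_factor.
  rewrite sum_nat_const mulnC => ->; rewrite mulnC -sum_nat_const big_mkcond [RHS]big_mkcond /=.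
  apply: eq_bigr => e _; rewrite inE; case: (boolP (e \in F)) => //= eF.
  case: ifP => [/setIidPl ->|eS]; first by rewrite card_ends2.
  apply/esym/eqP; rewrite cards_eq0; apply/eqP/setP => v; rewrite !inE; apply/andP => -[ve vS].
  by rewrite (F_ends e v) in eS.
have circ_FS e f : e \in FS -> f \in crc e -> f \in FS.
  move=> eFS; rewrite inE => /iter_findex <-; elim: findex => //= n.
  rewrite inE => /andP[nF nS]; have [v [nnF vn vnn _ _]] := next_spec F_factor s_v s_e nF.
  by rewrite inE nnF (F_ends _ v) // (fintype.subsetP nS).
have [e1 e1FS o1] : exists2 e, e \in FS & odd #|crc e|.
  apply: contrapT => alleven; move: oS; rewrite -FS_card -sum1_card.
  rewrite (partition_big_imset crc) /= -[odd _]negbK => /negP; apply.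
  rewrite -dvdn2; apply: dvdn_sum => _ /imsetP[e eFS ->].
  rewrite sum1_card; have -> : #|[pred f in FS | crc f == crc e]| = #|crc e|.
    apply: eq_card => f; apply/andP/idP => [[_ /eqP <-]|fe]; first exact: circ_refl.
    split; first exact: circ_FS fe.
    by apply/eqP/esym/(eq_circ F_factor s_v s_e); rewrite inE in fe.
  by rewrite dvdn2; apply/negP => oe; apply: alleven; exists e.
have /andP[e1F e1S] : (e1 \in F) && (ends e1 \subset S) by move: e1FS; rewrite inE.
have [v ve1 vm] : exists2 v, v \in ends e1 & v \notin ends m.
  apply: contrapT => all_m; have : ends e1 \subset ends m.
    by apply/fintype.subsetP => v ve; apply: contrapT => /negP vm; apply: all_m; exists v.
  move=> sub; have /eqP E : ends e1 == ends m by rewrite eqEcard sub !card_ends2.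
  have : m \in cutset S by rewrite Sm inE.
  by rewrite inE -E (setIidPl e1S) card_ends2.
have vS : v \in S := fintype.subsetP e1S v ve1.
have [m' m'F vm'] := matching_edge v.
have m'm : m' != m by apply: contraNneq vm => <-.
have [T ET] := lone v e1 m' e1F ve1 o1 m'F vm'.
have oS' : opp m' v \in S.
  have : m' \notin cutset S by rewrite Sm inE.
  by rewrite (in_cutset _ vm') negbK vS => /eqP <-.
have vT : (v \in T) != (opp m' v \in T) by rewrite -(in_cutset _ vm') ET inE.
have [w wm] := end_exists m.
have wS : (w \in S) != (opp m w \in S) by rewrite -(in_cutset _ wm) Sm inE.
have wT : (w \in T) = (opp m w \in T).
  apply/eqP; rewrite -[_ == _]negbK -(in_cutset _ wm) ET inE eq_sym; exact: m'm.
have agree h x : h != m -> h != m' -> x \in ends h ->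
    (x \in S) = (opp h x \in S) /\ (x \in T) = (opp h x \in T).
  move=> hm hm' xh; have : h \notin cutset S by rewrite Sm inE.
  have : h \notin cutset T by rewrite ET inE.
  by rewrite !(in_cutset _ xh) !negbK => /eqP-> /eqP->.
have smaller S' : S' \subset S -> (v \notin S') || (opp m' v \notin S') -> cutset S' = [set m'] -> False.
  move=> S'S out ES'; have := Smin S' (badP _ _ _ _ e1F ve1 o1 m'F vm' ES').
  apply/negP; rewrite -ltnNge; apply: proper_card; rewrite properE S'S.
  by apply/negP => /fintype.subsetP SS'; move: out; rewrite !SS'.
case wTb: (w \in T).
  apply: (smaller (S :\: T)); first exact: subsetDl.
    by rewrite !inE vS oS'; move: vT; do 2!case: (_ \in T).
  apply/setP => h; rewrite [RHS]inE; have [x xh] := end_exists h; rewrite (in_cutset _ xh) !inE.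
  case: (eqVneq h m') => [E|hm'].
    have [->|->] : x = v \/ x = opp m' v by apply: ends_cases vm'; rewrite -E.
      by rewrite E vS oS' !andbT; move: vT; do 2!case: (_ \in T).
    by rewrite E oppK vS oS' !andbT; move: vT; do 2!case: (_ \in T).
  case: (eqVneq h m) => [E|hm].
    have [->|->] : x = w \/ x = opp m w by apply: ends_cases wm; rewrite -E.
      by rewrite E -wT wTb.
    by rewrite E oppK -wT wTb.
  by have [<- <-] := agree h x hm hm' xh; rewrite eqxx.
apply: (smaller (S :&: T)); first exact: subsetIl.
  by rewrite !inE vS oS'; move: vT; do 2!case: (_ \in T).
apply/setP => h; rewrite [RHS]inE; have [x xh] := end_exists h; rewrite (in_cutset _ xh) !inE.
case: (eqVneq h m') => [E|hm'].
  have [->|->] : x = v \/ x = opp m' v by apply: ends_cases vm'; rewrite -E.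
    by rewrite E vS oS' /=; move: vT; do 2!case: (_ \in T).
  by rewrite E oppK vS oS' /=; move: vT; do 2!case: (_ \in T).
case: (eqVneq h m) => [E|hm].
  have [->|->] : x = w \/ x = opp m w by apply: ends_cases wm; rewrite -E.
    by rewrite E -wT wTb !andbF.
  by rewrite E oppK -wT wTb !andbF.
by have [<- <-] := agree h x hm hm' xh; rewrite eqxx.
Qed.

(** Breaking the odd circuit through [v] at one or the other of its edges [e], [f] at
    [v] gives two sets of negative edges which differ in [e] and [f] only. If both
    were complements of cuts, then [e] and [f] would form a cut, and together with
    the star of [v] the third edge [m] at [v] would be one. *)
Lemma broken_not_cocut : ~~ edge_colorable G 3 ->
  exists N : {set edge G}, [/\ has_flow (4%R : R) N, ~ cocut N & #|N| <= odd_circuits F].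
Proof.
move=> nc.
have root_conn e : fconnect nxt (froot nxt e) e by rewrite nxt_sym connect_root.
have root_cls e f : fconnect nxt e f -> froot nxt e = froot nxt f.
  by move=> ef; apply/eqP; rewrite (root_connect nxt_sym).
have /set0Pn[e0] : broken F s (froot nxt) != finset.set0.
  by apply: contraNneq nc => nb; apply: unbroken_colorable nb.
rewrite inE => /and3P[e0F _ o0].
have [v [e [m [[eF ve oe mF] [vm noW]]]]] := odd_circuit_nonbridge e0F o0.
have [f [fF vf ef]] : exists f, [/\ f \in F, v \in ends f & e != f].
  have eFv : e \in F :&: inc v by rewrite !inE eF.
  have /factorP/(_ v) F2 := F_factor.
  exists (mate (F :&: inc v) e); have := mate_in eFv; rewrite !inE => /andP[-> ->].
  by split=> //; rewrite eq_sym mate_neq ?F2.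
have cef := meet_connect F_factor s_v s_e eF fF ve vf.
have of_ : odd #|crc f| by rewrite -(eq_circ F_factor s_v s_e cef).
pose N e1 := broken F s (root_at e1).
have Nflow e1 : has_flow (4%R : R) (N e1).
  by apply: broken_flow; [exact: root_at_connect|exact: root_at_class].
have Ncard e1 : #|N e1| <= odd_circuits F.
  by apply: card_broken => //; exact: root_at_class.
have [[A EA]|] := pselect (cocut (N e)); last by exists (N e).
have [[B EB]|] := pselect (cocut (N f)); last by exists (N f).
case: (noW (sdiff (sdiff A B) [set v])); apply/setP => h.
rewrite !in_cutset_sdiff cutset1 in_inc inE.
have -> : (h \in cutset A) (+) (h \in cutset B) = (h \in N e) (+) (h \in N f).
  by rewrite EA EB !in_setC addNb addbN negbK.
have -> : (h \in N e) (+) (h \in N f) = (h == e) || (h == f).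
  rewrite !in_broken_at // (same_connect nxt_sym cef).
  case: ifP => fh; first by case: (eqVneq h e) => [->|//]; rewrite (negbTE ef).
  rewrite addbb; apply/esym/negbTE; rewrite negb_or; apply/andP; split; apply/eqP => E.
    by move: fh; rewrite E nxt_sym cef.
  by move: fh; rewrite E connect0.
have Fv : F :&: inc v = [set e; f].
  apply/esym/eqP; rewrite eqEcard cards2 ef; have /factorP/(_ v) -> := F_factor.
  by rewrite andbT; apply/fintype.subsetP => x; rewrite !inE => /orP[] /eqP->; rewrite ?eF ?fF ?ve ?vf.
have : (h \in F :&: inc v) = (h \in [set e; f]) by rewrite Fv.
rewrite !inE => <-; case: (boolP (h \in F)) => hF /=.
  by rewrite addbb; apply/esym/negbTE; apply: contraNneq mF => <-.
apply/idP/eqP => [vh|->]; last exact: vm.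
exact: matching_uniq hF mF vh vm.
Qed.

End BrokenCircuits.

(** * Bipartite and 3-edge-colourable graphs *)

Section Bipartite.
Variables (R : realType) (G : multigraph).
Hypothesis G_cubic : cubic G.
Implicit Types (N M F : {set edge G}) (A B S T W : {set vertex G}).
Implicit Types (e f h : edge G) (u v w x : vertex G).

Lemma proper_coloringP k (c : {ffun edge G -> 'I_k}) :
  reflect (forall v e f, v \in ends e -> v \in ends f -> e != f -> c e != c f)
          (proper_edge_coloring c).
Proof.
apply: (iffP forallP) => [H v e f ve vf ef|H e].
  have /forallP/(_ f)/implyP := H e; apply; rewrite ef.
  by apply/set0Pn; exists v; rewrite inE ve.
apply/forallP => f; apply/implyP => /andP[ef /set0Pn[v /setIP[ve vf]]].
exact: H ve vf ef.
Qed.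

Lemma color_at (c : {ffun edge G -> 'I_3}) v i : proper_edge_coloring c ->
  exists2 e, v \in ends e & c e = i.
Proof.
move=> /proper_coloringP c_proper.
have : i \in c @: inc v.
  suff -> : c @: inc v = [set: 'I_3] by rewrite inE.
  apply/eqP; rewrite eqEcard finset.subsetT cardsT card_ord card_in_imset ?card_inc //.
  move=> e f; rewrite !in_inc => ve vf cef; apply/eqP; apply: contraT => ef.
  by have := c_proper v e f ve vf ef; rewrite cef eqxx.
by case/imsetP => e; rewrite in_inc => ve ->; exists e.
Qed.

Lemma color_class_factor (c : {ffun edge G -> 'I_3}) i : proper_edge_coloring c ->
  is_factor 1 [set e | c e == i].
Proof.
move=> c_proper; apply/factorP => v; have [e ve ci] := color_at v i c_proper.
apply/eqP/cards1P; exists e; apply/setP => f; rewrite !inE.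
apply/andP/eqP => [[/eqP cf vf]|->]; last by rewrite ci eqxx.
apply/eqP; apply: contraT => fe; have /proper_coloringP/(_ v f e vf ve fe) := c_proper.
by rewrite ci cf eqxx.
Qed.

(** Colour 0 is a 1-factor and the other two colours form a 2-factor; both halves
    of an edge have the same colour, so no edge is negative. *)
Lemma colorable_flow : edge_colorable G 3 -> has_flow (4%R : R) (finset.set0 : {set edge G}).
Proof.
case/existsP => c c_proper.
have M_factor := color_class_factor (ord0 : 'I_3) c_proper.
have F_factor := factorC G_cubic M_factor isT.
apply: (half_coloring_flow R G_cubic (d := fun _ e => c e == inord 1) F_factor).
- move=> v e f; rewrite !inE => e0 f0 ve vf ef.
  have /proper_coloringP/(_ v e f ve vf ef) := c_proper.
  move: e0 f0; rewrite -!val_eqE /= !inordK //.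
  by move: (c e) (c f) => [[|[|[]]] //= _] [[|[|[]]] //= _].
- exact: finset.sub0set.
- by move=> v e _ _; rewrite inE eqxx.
- by move=> t; exists (fun=> true); split=> // e; rewrite inE.
Qed.

Lemma bipartite_colorable A M : cutset A = [set: edge G] -> is_factor 1 M -> edge_colorable G 3.
Proof.
move=> EA M_factor; have /factorP F2 := factorC G_cubic M_factor isT.
have [|v|c c_alt] := @bipartite_two_coloring G A (~: M); first by rewrite EA finset.subsetT.
  by rewrite F2.
apply/existsP; exists [ffun e => if e \in M then ord0 else if c e then inord 1 else inord 2].
apply/proper_coloringP => v e f ve vf ef; rewrite !ffunE.
case: (boolP (e \in M)) => eM; case: (boolP (f \in M)) => fM.
- have /factorP/(_ v)/eqP/cards1P[m Em] := M_factor.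
  have : e \in M :&: inc v by rewrite !inE eM.
  have : f \in M :&: inc v by rewrite !inE fM.
  by rewrite Em !inE => /eqP fm /eqP em; move: ef; rewrite fm em eqxx.
- by case: ifP => _; rewrite -val_eqE /= inordK.
- by case: ifP => _; rewrite -val_eqE /= inordK.
- rewrite (c_alt v e f) ?inE //; by case: (c e); rewrite -val_eqE /= !inordK.
Qed.

(** In the bipartite 3-flow the edge [b] outside the 1-factor is reversed and raised
    from 1 to 3; both matching edges at its ends then change sign
    there, but not at their far ends. *)
Lemma bipartite_flow A M b v a1 a2 : cutset A = [set: edge G] -> is_factor 1 M ->
    b \notin M -> v \in ends b -> a1 \in M -> v \in ends a1 -> a2 \in M -> opp b v \in ends a2 ->
    a1 != a2 ->
  has_flow (4%R : R) [set a1; a2].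
Proof.
move=> EA /factorP M1 bM vb a1M va1 a2M wa2 a12.
have M_uniq x e f : e \in M -> f \in M -> x \in ends e -> x \in ends f -> e = f.
  move=> eM fM xe xf; have /eqP/cards1P[m Em] := M1 x.
  have : e \in M :&: inc x by rewrite !inE eM.
  have : f \in M :&: inc x by rewrite !inE fM.
  by rewrite Em !inE => /eqP-> /eqP->.
pose sA x : R := (if x \in A then 1 else -1)%R.
(* The value at [x], up to the sign given by the side of [x]. *)
pose k x e : R := (if x \in ends b then (if e \in M then -2 else if e == b then 3 else -1)
                   else if e \in M then 2 else -1)%R.
have sA_opp x e : x \in ends e -> sA (opp e x) = (- sA x)%R.
  move=> xe; have : e \in cutset A by rewrite EA.
  by rewrite (in_cutset _ xe) /sA; do 2!case: (_ \in A); rewrite //= ?opprK.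
have k_sum x : (\sum_(e in inc x) k x e = 0)%R.
  have /eqP/cards1P[m Em] := M1 x.
  have : m \in M :&: inc x by rewrite Em inE.
  rewrite !inE => /andP[mM xm]; have [f [h H]] := inc_split G_cubic xm.
  have notM e : x \in ends e -> m != e -> e \notin M.
    by move=> xe me; apply: contraNN me => eM; rewrite (M_uniq x m e).
  rewrite (sum_inc _ H); case: H => mf mh fh Ex.
  have xf : x \in ends f by rewrite -in_inc Ex !inE eqxx orbT.
  have xh : x \in ends h by rewrite -in_inc Ex !inE eqxx orbT.
  rewrite /k mM (negbTE (notM f xf mf)) (negbTE (notM h xh mh)).
  case: ifP => [xb|_]; last by lra.
  have : b \in [set m; f; h] by rewrite -Ex in_inc.
  rewrite !inE => /orP[/orP[]|] /eqP Eb; first by rewrite Eb mM in bM.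
    by rewrite Eb eqxx eq_sym (negbTE fh); lra.
  by rewrite Eb eqxx (negbTE fh); lra.
exists (fun x e => sA x * k x e)%R; split=> [x|x e xe|x e xe].
- by rewrite -big_distrr /= k_sum mulr0.
- rewrite normrM; have -> : (`|sA x| = 1)%R by rewrite /sA; case: ifP; rewrite ?normrN normr1.
  rewrite mul1r /k; repeat (case: ifP => _);
  by rewrite ?normrN ?normr1 ?ger0_norm //; apply/andP; split; lra.
rewrite sA_opp // mulNr; have kE : k (opp e x) e = if e \in [set a1; a2] then (- k x e)%R else k x e.
  rewrite /k; case: (boolP (e \in M)) => eM; last first.
    have -> : (e \in [set a1; a2]) = false.
      by apply/negbTE; apply: contra eM; rewrite !inE => /orP[] /eqP->.
    case: (eqVneq e b) => [E|_]; last by do 2!case: ifP.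
    by rewrite -E xe opp_in.
  case: (boolP (e \in [set a1; a2])) => eN.
    suff -> : (opp e x \in ends b) = (x \notin ends b) by case: (x \in ends b) => /=; rewrite ?opprK.
    have key y a c : y \in ends b -> a \in M -> c \in M -> y \in ends a -> opp b y \in ends c ->
        a != c -> x \in ends a -> (opp a x \in ends b) = (x \notin ends b).
      move=> yb aM cM ya yc ac xa.
      have oya : opp a y \notin ends b.
        apply/negP => oyb; have [oy|oy] := ends_cases oyb yb.
          by have := opp_neq ya; rewrite oy eqxx.
        by move: ac; rewrite (M_uniq _ a c aM cM _ yc) ?eqxx // -oy opp_in.
      have [->|->] := ends_cases xa ya; first by rewrite yb (negbTE oya).
      by rewrite oppK yb oya.
    move: eN; rewrite !inE => /orP[] /eqP E; rewrite E in xe *.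
      exact: (key v _ a2).
    apply: (key (opp b v) _ a1) => //; rewrite ?opp_in ?oppK // eq_sym //.
  have notb y : y \in ends e -> y \in ends b -> False.
    move=> ye yb; case/negP: eN; rewrite !inE.
    have [Ey|Ey] := ends_cases yb vb; rewrite Ey in ye.
      by rewrite (M_uniq _ e a1 eM a1M ye va1) eqxx.
    by rewrite (M_uniq _ e a2 eM a2M ye wa2) eqxx orbT.
  case: ifP => [/(notb _ (opp_in xe))//|_]; by case: ifP => // /(notb _ xe).
rewrite kE; case: ifP => _ //; by rewrite mulrN opprK.
Qed.

(** In a 3-edge-colouring let [a] and [b] be adjacent at [v] with different far
    ends [v0] and [v2]; let [a2] have the colour of [a] at [v2] and [b0] the colour
    of [b] at [v0], so that [b0], [a], [b], [a2] are consecutive edges. Both pairs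
    [a], [a2] and [b], [b0] are negative edges of flows. If both were complements of
    cuts they would be cuts, as all edges together form one. The vertices on the
    side of [v] for both cuts would then be left only by [a] and [b], so without [v]
    they would be left only by the third edge [h] at [v], against [no_lone_cut]. *)
Lemma bipartite_four_flow M v a b : bipartite G -> is_factor 1 M ->
    v \in ends a -> v \in ends b -> ends a != ends b ->
  exists N, [/\ has_flow (4%R : R) N, ~ cocut N & #|N| = 2].
Proof.
move=> /existsP[A /forallP A1] M_factor va vb ab_par.
have EA : cutset A = [set: edge G] by apply/setP => e; rewrite !inE A1.
have flow0 : has_flow (3%R : R) (finset.set0 : {set edge G}).
  by rewrite -(setCT) -EA; apply: cut_flow M_factor.
have ab : a != b by apply: contraNneq ab_par => ->.
have /existsP[c c_proper] := bipartite_colorable EA M_factor.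
have c_neq x e f : x \in ends e -> x \in ends f -> e != f -> c e != c f.
  by have /proper_coloringP := c_proper; apply.
have cab := c_neq v a b va vb ab.
pose v0 := opp a v; pose v2 := opp b v.
have v02 : v0 != v2.
  by apply: contraNneq ab_par => E; rewrite (ends_opp va) (ends_opp vb) -/v0 E.
have [a2 va2 ca2] := color_at v2 (c a) c_proper.
have [b0 vb0 cb0] := color_at v0 (c b) c_proper.
have v2a : v2 \notin ends a.
  by rewrite (ends_opp va) !inE negb_or opp_neq //= eq_sym.
have v0b : v0 \notin ends b by rewrite (ends_opp vb) !inE negb_or opp_neq.
have aa2 : a != a2 by apply: contraNneq v2a => ->.
have bb0 : b != b0 by apply: contraNneq v0b => ->.
have flow1 : has_flow (4%R : R) [set a; a2].
  by apply: (bipartite_flow EA (color_class_factor (c a) c_proper) (b := b) (v := v)); rewrite // inE ?ca2 // eq_sym.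
have flow2 : has_flow (4%R : R) [set b; b0].
  by apply: (bipartite_flow EA (color_class_factor (c b) c_proper) (b := a) (v := v)); rewrite // inE ?cb0.
have [[B EB]|] := pselect (cocut [set a; a2]); last by exists [set a; a2]; rewrite cards2 aa2.
have [[C EC]|] := pselect (cocut [set b; b0]); last by exists [set b; b0]; rewrite cards2 bb0.
have cutS e x : x \in ends e -> (e \in [set a; a2]) =
    (((x \in sdiff A B) == (v \in sdiff A B)) != ((opp e x \in sdiff A B) == (v \in sdiff A B))).
  move=> xe; transitivity (e \in cutset (sdiff A B)); last first.
    by rewrite (in_cutset _ xe); do 3!case: (_ \in _).
  by rewrite EB in_setC in_cutset_sdiff EA in_setT addTb.
have cutT e x : x \in ends e -> (e \in [set b; b0]) =
    (((x \in sdiff A C) == (v \in sdiff A C)) != ((opp e x \in sdiff A C) == (v \in sdiff A C))).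
  move=> xe; transitivity (e \in cutset (sdiff A C)); last first.
    by rewrite (in_cutset _ xe); do 3!case: (_ \in _).
  by rewrite EC in_setC in_cutset_sdiff EA in_setT addTb.
pose S := [set x | (x \in sdiff A B) == (v \in sdiff A B)].
pose T := [set x | (x \in sdiff A C) == (v \in sdiff A C)].
(* [S] and [T] are the sides of [v] for the two cuts. *)
have {}cutS e x : x \in ends e -> (e \in [set a; a2]) = ((x \in S) != (opp e x \in S)).
  by move=> /cutS->; rewrite !in_set.
have {}cutT e x : x \in ends e -> (e \in [set b; b0]) = ((x \in T) != (opp e x \in T)).
  by move=> /cutT->; rewrite !in_set.
have vS : v \in S by rewrite in_set eqxx.
have vT : v \in T by rewrite in_set eqxx.
clearbody S T.
have a_T : a \notin [set b; b0].
  by rewrite !inE negb_or ab; apply: contraNneq cab => E; rewrite E cb0.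
have b_S : b \notin [set a; a2].
  by rewrite !inE negb_or eq_sym ab; apply: contraNneq cab => E; rewrite E ca2.
have v0S : v0 \notin S.
  by have := cutS a v va; rewrite !inE eqxx vS -/v0; case: (v0 \in S).
have v0T : v0 \in T.
  by have := cutT a v va; rewrite (negbTE a_T) vT -/v0; case: (v0 \in T).
have v2T : v2 \notin T.
  by have := cutT b v vb; rewrite !inE eqxx vT -/v2; case: (v2 \in T).
have v2S : v2 \in S.
  by have := cutS b v vb; rewrite (negbTE b_S) vS -/v2; case: (v2 \in S).
have /cards1P[h Eh] : #|inc v :\ a :\ b| == 1.
  have := card_inc G_cubic v; rewrite (cardsD1 a) in_inc va (cardsD1 b) !inE eq_sym ab vb.
  by rewrite add1n add1n => -[->].
have : h \in inc v :\ a :\ b by rewrite Eh inE.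
rewrite 2!in_setD1 in_inc => /and3P[hb ha hv].
have Ev : inc v = [set a; b; h].
  by rewrite -setUA -Eh setD1K ?setD1K ?in_setD1 ?in_inc ?va // eq_sym ab vb.
case: (no_lone_cut flow0 (W := (S :&: T) :\ v) (e := h)); apply/setP => e.
have [x xe] := end_exists e; rewrite (in_cutset _ xe) !in_setD1 !in_setI in_set1.
case: (boolP (v \in ends e)) => ve.
  have -> : ((x != v) && ((x \in S) && (x \in T))
     != (opp e x != v) && ((opp e x \in S) && (opp e x \in T))) =
     (opp e v \in S) && (opp e v \in T).
    have [->|->] := ends_cases xe ve; rewrite ?oppK eqxx opp_neq //=;
    by case: (_ && _).
  have : e \in inc v by rewrite in_inc.
  rewrite Ev !inE => /orP[/orP[]|] /eqP->.
  - by rewrite -/v0 (negbTE v0S) eq_sym (negbTE ha).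
  - by rewrite -/v2 (negbTE v2T) andbF eq_sym (negbTE hb).
  - rewrite eqxx; have := cutS h v hv; have := cutT h v hv; rewrite vS vT !inE (negbTE ha) (negbTE hb).
    have -> : (h == a2) = false.
      by apply/eqP => E; have := c_neq v h a hv va ha; rewrite E ca2 eqxx.
    have -> : (h == b0) = false.
      by apply/eqP => E; have := c_neq v h b hv vb hb; rewrite E cb0 eqxx.
    by do 2!case: (_ \in _).
have -> : (e == h) = false by apply/eqP => E; rewrite E hv in ve.
have xv : x != v by apply: contraNneq ve => <-.
have oxv : opp e x != v by apply: contraNneq ve => <-; apply: opp_in.
rewrite xv oxv /=.
case: (eqVneq e a2) => [E|ea2].
  have far y : y \in ends a2 -> (y \in S) && (y \in T) = false.
    move=> ya2; have [->|->] := ends_cases ya2 va2; first by rewrite (negbTE v2T) andbF.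
    by have := cutS a2 v2 va2; rewrite !inE eqxx orbT v2S; case: (_ \in S).
  by rewrite !far // -E ?opp_in.
case: (eqVneq e b0) => [E|eb0].
  have far y : y \in ends b0 -> (y \in S) && (y \in T) = false.
    move=> yb0; have [->|->] := ends_cases yb0 vb0; first by rewrite (negbTE v0S).
    have := cutT b0 v0 vb0; rewrite !inE eqxx orbT v0T.
    by case: (_ \in T) => //; rewrite andbF.
  by rewrite !far // -E ?opp_in.
have := cutS e x xe; have := cutT e x xe; rewrite !inE (negbTE ea2) (negbTE eb0).
have -> : (e == a) = false by apply/eqP => E; rewrite E va in ve.
have -> : (e == b) = false by apply/eqP => E; rewrite E vb in ve.
by move=> /esym/negbFE/eqP-> /esym/negbFE/eqP->; rewrite eqxx.
Qed.

End Bipartite.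

(** * Graphs in which adjacent edges are parallel *)

(** Index the values of [f] and, inside each fibre, its elements. *)
Lemma uniform_fibers_bij (T U : finType) (k : nat) (f : T -> U) (P : {set U}) :
    (forall x, f x \in P) -> (forall B, B \in P -> #|[set x | f x == B]| = k.+1) ->
  exists phi : T -> 'I_#|P| * 'I_k.+1,
    bijective phi /\ forall x, enum_val (phi x).1 = f x.
Proof.
move=> fP fibers.
pose fib x := [set y | f y == f x].
pose phi x := (enum_rank_in (fP x) (f x), inord (index x (enum (fib x))) : 'I_k.+1).
have phi1 x : enum_val (phi x).1 = f x by rewrite enum_rankK_in.
have idx x : index x (enum (fib x)) < k.+1.
  by rewrite -(fibers _ (fP x)) cardE index_mem mem_enum inE.
exists phi; split=> //; apply: inj_card_bij => [x y E|].
  have fxy : f x = f y by rewrite -!phi1 E.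
  have fibxy : fib x = fib y by rewrite /fib fxy.
  have /(congr1 (fun p => val p.2)) := E; rewrite /= !inordK ?idx // fibxy => Ei.
  have xf : x \in enum (fib y) by rewrite mem_enum inE fxy.
  have yf : y \in enum (fib y) by rewrite mem_enum inE.
  by have := nth_index x xf; rewrite Ei nth_index // => <-.
rewrite card_prod !card_ord; have -> // : #|T| = #|P| * k.+1.
rewrite -sum_nat_const -sum1_card (partition_big f (mem P)) //=.
apply: eq_bigr => B BP; rewrite sum1_card -(fibers B BP).
by apply: eq_card => x; rewrite inE.
Qed.

Lemma parallel_copies (G : multigraph) : cubic G ->
    (forall (v : vertex G) (e f : edge G), v \in ends e -> v \in ends f -> ends e = ends f) ->
  exists n, isomorphic G (copies n K23).
Proof.
move=> G_cubic par.
have ex_e (v : vertex G) : exists e : edge G, v \in ends e.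
  have /card_gt0P[e] : 0 < #|inc v| by rewrite (card_inc G_cubic).
  by rewrite in_inc; exists e.
pose blk v := ends (xchoose (ex_e v)).
have blkE v e : v \in ends e -> blk v = ends e.
  by move=> ve; apply: par ve; apply: (xchooseP (ex_e v)).
pose P := [set ends e | e : edge G].
have PE B : B \in P -> exists e, B = ends e by case/imsetP => e _ ->; exists e.
have [||phi [phi_bij phi1]] := @uniform_fibers_bij _ _ 1 blk P.
- by move=> v; apply: imset_f.
- move=> B /PE[e ->]; rewrite -(card_ends2 e); apply: eq_card => v; rewrite !inE.
  by apply/eqP/idP => [<-|/blkE//]; apply: (xchooseP (ex_e v)).
have [||psi [psi_bij psi1]] := @uniform_fibers_bij _ _ 2 (@ends G) P.
- by move=> e; apply: imset_f.
- move=> B /PE[e ->]; have [v ve] := end_exists e; rewrite -(card_inc G_cubic v).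
  apply: eq_card => f; rewrite !inE; apply/eqP/idP => [->//|vf]; exact: par vf ve.
exists #|P|, phi, psi; split=> // e; apply/esym/eqP; rewrite eqEcard.
rewrite card_imset ?card_ends ?leqnn ?andbT; last exact: bij_inj.
apply/fintype.subsetP => _ /imsetP[v ve ->]; apply/imsetP; exists (phi v).2; first by rewrite inE.
have -> : (psi e).1 = (phi v).1 by apply: enum_val_inj; rewrite phi1 psi1 (blkE v e).
exact: surjective_pairing.
Qed.

(** * The Tutte-Berge formula and 1-factors through an edge *)

Section TutteBerge.
Variable G : multigraph.
Implicit Types (N M : {set edge G}) (W U Q : {set vertex G}) (P : {set {set vertex G}}).
Implicit Types (e f : edge G) (u v w x y t : vertex G).

Definition matching W N : bool :=
  [forall e in N, ends e \subset W] && [forall v, #|N :&: inc v| <= 1].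

Definition max_matching W N : Prop :=
  matching W N /\ forall N', matching W N' -> #|N'| <= #|N|.

Definition covered N : {set vertex G} := [set v | N :&: inc v != finset.set0].

Lemma matchingP W N : reflect
  ((forall e v, e \in N -> v \in ends e -> v \in W) /\
   (forall v e f, e \in N -> f \in N -> v \in ends e -> v \in ends f -> e = f)) (matching W N).
Proof.
apply: (iffP andP) => [[/forallP NW /forallP N1]|[NW N1]]; split.
- by move=> e v eN; have := NW e; rewrite eN => /fintype.subsetP; apply.
- move=> v e f eN fN ve vf; have /card_le1_eqP := N1 v; apply; by rewrite !inE ?eN ?fN.
- by apply/forallP => e; apply/implyP => eN; apply/fintype.subsetP => v; apply: NW.
- apply/forallP => v; apply/card_le1_eqP => e f; rewrite !inE => /andP[eN ve] /andP[fN vf].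
  exact: N1 vf ve.
Qed.

Lemma coveredP N v : reflect (exists2 e, e \in N & v \in ends e) (v \in covered N).
Proof.
rewrite inE; apply: (iffP (set0Pn _)) => [[e]|[e eN ve]].
  by rewrite !inE => /andP[]; exists e.
by exists e; rewrite !inE eN.
Qed.

Lemma max_matching_exists W : exists N, max_matching W N.
Proof.
have m0 : matching W finset.set0 by apply/matchingP; split=> [e v|v e f]; rewrite inE.
have [N mN Nmax] := arg_maxnP (fun N => #|N|) m0; by exists N.
Qed.

Lemma card_covered W N : matching W N -> #|covered N| = 2 * #|N|.
Proof.
move=> /andP[_ /forallP N1]; rewrite -double_countT -sum1_card big_mkcond /=.
apply: eq_bigr => v _; rewrite inE -cards_eq0.
by case: #|_| (N1 v) => [|[|]].
Qed.

Lemma covered_sub W N : matching W N -> covered N \subset W.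
Proof.
by case/matchingP => NW _; apply/fintype.subsetP => v /coveredP[e eN]; apply: NW eN.
Qed.

Lemma matching_add W N e : matching W N -> ends e \subset W ->
  (forall v, v \in ends e -> v \notin covered N) -> matching W (e |: N).
Proof.
move=> /matchingP[NW N1] eW eN; apply/matchingP; split=> [f v|v f h].
  by rewrite !inE => /orP[/eqP->|/NW]; [apply: (fintype.subsetP eW)|apply].
have no k : k \in N -> v \in ends e -> v \in ends k -> False.
  by move=> kN ve vk; have /negP := eN v ve; apply; apply/coveredP; exists k.
rewrite !inE => /orP[/eqP->|fN] /orP[/eqP->|hN] // vf vh; [case: (no h)|case: (no f)|] => //.
exact: N1 vf vh.
Qed.

Lemma matching_sub W N N' : matching W N -> N' \subset N -> matching W N'.
Proof.
move=> /matchingP[NW N1] /fintype.subsetP sub; apply/matchingP; split=> [e v /sub|v e f /sub eN /sub fN].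
  exact: NW.
exact: N1.
Qed.

Lemma max_matching_card W N N' : max_matching W N -> max_matching W N' -> #|N| = #|N'|.
Proof. by move=> [m1 max1] [m2 max2]; apply/eqP; rewrite eqn_leq max1 ?max2. Qed.

(** The relation behind Gallai's lemma; adjacent vertices are
    related, since the edge between two missed vertices could be added. *)
Definition never_missed_together W u v : Prop :=
  u = v \/ forall N, max_matching W N -> u \in covered N \/ v \in covered N.

(** Suppose that a maximum matching [M] misses [u] and [v], and let [N] be a maximum
    matching which misses [t] and shares as many edges as possible with [M]. Then
    [N] covers [u] and [v], so by counting [M] covers a vertex [x] other than [t] that
    [N] misses. Exchanging an edge of [N] for the edge of [M] at [x] gives more
    common edges. *)
Lemma never_missed_trans W u t v :
    (exists2 N, max_matching W N & t \notin covered N) ->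
  never_missed_together W u t -> never_missed_together W t v -> never_missed_together W u v.
Proof.
move=> [N0 [N0m N0max] N0t] [->//|ut] [<-|tv]; first by right.
case: (eqVneq u v) => [|uv]; [by left|right=> M [Mm Mmax]].
case: (boolP (u \in covered M)) => uM; first by left.
case: (boolP (v \in covered M)) => vM; [by right|exfalso].
have tM : t \in covered M by have [|//] := ut M (conj Mm Mmax); rewrite (negbTE uM).
pose good N := [&& matching W N, #|N| == #|N0| & t \notin covered N].
have good0 : good N0 by rewrite /good N0m eqxx.
have [N /and3P[Nm /eqP NN0 Nt] Nbest] := arg_maxnP (fun N => #|M :&: N|) good0.
have Nmax : max_matching W N by split=> // N'; rewrite NN0; apply: N0max.
have uN : u \in covered N by have [//|] := ut N Nmax; rewrite (negbTE Nt).
have vN : v \in covered N by have [|//] := tv N Nmax; rewrite (negbTE Nt).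
have [x] : exists x, x \in (covered M :\: covered N) :\ t.
  have two : 2 <= #|covered N :\: covered M|.
    rewrite -(_ : #|[set u; v]| = 2); last by rewrite cards2 uv.
    apply/subset_leq_card/fintype.subsetP => y; rewrite !inE => /orP[] /eqP->.
      by move: uN uM; rewrite !inE => -> ->.
    by move: vN vM; rewrite !inE => -> ->.
  apply/card_gt0P; have := cardsD1 t (covered M :\: covered N).
  rewrite in_setD Nt tM /= => E.
  have eqc : #|covered M :\: covered N| = #|covered N :\: covered M|.
    apply: (@addnI #|covered M :&: covered N|); rewrite cardsID setIC cardsID.
    by rewrite (card_covered Mm) (card_covered Nm) (max_matching_card (conj Mm Mmax) Nmax).
  by move: two; rewrite -eqc E add1n ltnS.
rewrite in_setD1 in_setD => /and3P[xt xN /coveredP[e eM xe]].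
have /matchingP[MW M1] := Mm; have /matchingP[NW N1] := Nm.
pose y := opp e x; have ye : y \in ends e by apply: opp_in.
have eN : e \notin N by apply: contraNN xN => eN; apply/coveredP; exists e.
have eW : ends e \subset W by apply/fintype.subsetP => w; apply: MW eM.
have [f fN yf] : exists2 f, f \in N & y \in ends f.
  apply/coveredP; apply: contraT => yN.
  have /(proj2 Nmax) : matching W (e |: N).
    by apply: matching_add => // w we; have [->|->] := ends_cases we xe.
  by rewrite cardsU1 eN add1n ltnn.
have fM : f \notin M.
  by apply: contraNN xN => fM; apply/coveredP; exists f; rewrite // -(M1 y e f).
have Nf1 : y \notin covered (N :\ f).
  apply/coveredP => -[h]; rewrite !inE => /andP[hf hN] yh.
  by move: hf; rewrite (N1 y h f) ?eqxx.
have Nfm : matching W (e |: (N :\ f)).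
  apply: matching_add => //; first by apply: matching_sub Nm _; apply: subD1set.
  move=> w we; have [->|->] := ends_cases we xe; last exact: Nf1.
  by apply: contraNN xN => /coveredP[h /setD1P[_ hN] xh]; apply/coveredP; exists h.
have : good (e |: (N :\ f)).
  rewrite /good Nfm -NN0 cardsU1 in_setD1 (negbTE eN) andbF [in X in _ == X](cardsD1 f) fN eqxx /=.
  apply/coveredP => -[h]; rewrite !inE => /orP[/eqP->|/andP[_ hN]] th; last first.
    by case/negP: Nt; apply/coveredP; exists h.
  have [E|E] := ends_cases th xe; first by rewrite E eqxx in xt.
  by case/negP: Nt; rewrite E; apply/coveredP; exists f.
move/Nbest; apply/negP; rewrite -ltnNge.
have -> : M :&: (e |: (N :\ f)) = e |: (M :&: N).
  apply/setP => h; rewrite !inE; case: (eqVneq h e) => [->|_] /=; first by rewrite eM.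
  by case: (eqVneq h f) => [->|_] //=; rewrite (negbTE fM).
by rewrite cardsU1 !inE (negbTE eN) andbF.
Qed.

(** The formula for the subgraph induced on [W]; only the inequality that produces
    the barrier [U] is stated, with the odd components as the family [P]. If some
    vertex is covered by all maximum matchings, it is put into [U] and removed.
    Otherwise [never_missed_together] is transitive on [W], so a maximum matching
    misses at most one vertex of each component; take [U] empty and for [P] the
    components with a missed vertex, which are odd. *)
Theorem tutte_berge W N : max_matching W N ->
  exists U P, [/\ U \subset W, trivIset P,
    forall Q, Q \in P -> Q \subset W :\: U /\ odd #|Q|,
    forall Q e v, Q \in P -> ends e \subset W -> v \in ends e -> v \in Q -> ends e \subset Q :|: U
  & #|W| + #|U| <= 2 * #|N| + #|P|].
Proof.
have [n] := ubnP #|W|; elim: n W N => // n IHn W N Wn Nmax.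
have [[x xW xcov]|nocov] := pselect (exists2 x, x \in W & forall N', max_matching W N' -> x \in covered N').
  have [N' N'max] := max_matching_exists (W :\ x).
  have [|U [P [UW Ptriv Podd Pedge card]]] := IHn (W :\ x) N' _ N'max.
    by move: Wn; rewrite (cardsD1 x) xW.
  have N'W : matching W N'.
    have /matchingP[N'W N'1] := proj1 N'max; apply/matchingP; split=> // e v eN ve.
    by have := N'W e v eN ve; rewrite in_setD1 => /andP[].
  have ltN : #|N'| < #|N|.
    rewrite ltn_neqAle (proj2 Nmax) // andbT; apply/eqP => E.
    have : x \in covered N' by apply: xcov; split=> // N''; rewrite E; apply: (proj2 Nmax).
    by move/(fintype.subsetP (covered_sub (proj1 N'max))); rewrite !inE eqxx.
  have xU : x \notin U by apply/negP => /(fintype.subsetP UW); rewrite !inE eqxx.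
  exists (x |: U), P; split=> //.
  - by rewrite subUset sub1set xW (subset_trans UW) ?subD1set.
  - move=> Q /Podd[QW ->]; split=> //; apply: subset_trans QW _.
    by apply/fintype.subsetP => y; rewrite !inE negb_or => /and3P[-> -> ->].
  - move=> Q e v QP eW ve vQ; case: (boolP (x \in ends e)) => xe.
      have vx : v != x.
        by apply: contraTneq vQ => ->; apply/negP => /(fintype.subsetP (proj1 (Podd Q QP))); rewrite !inE eqxx andbF.
      apply/fintype.subsetP => w we; rewrite !inE.
      have [->|->] := ends_cases we ve; first by rewrite vQ.
      by rewrite (opp_eq ve xe) // eqxx orbT.
    have eWx : ends e \subset W :\ x.
      apply/fintype.subsetP => w we; rewrite !inE (fintype.subsetP eW) // andbT.
      by apply: contraNneq xe => <-.
    apply: subset_trans (Pedge Q e v QP eWx ve vQ) _.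
    by apply: setUS; apply: finset.subsetUr.
  - move: card; rewrite cardsU1 xU; rewrite [#|W|](cardsD1 x) xW; lia.
pose a : rel (vertex G) := [rel x y | [&& x \in W, y \in W & [exists e, ends e == [set x; y]]]].
have a_sym : symmetric a.
  move=> x y; rewrite /a /= andbCA; congr [&& _, _ & _].
  by apply: eq_existsb => e; rewrite setUC.
have csym : connect_sym a by apply: sym_connect_sym.
have never x y : x \in W -> connect a x y -> never_missed_together W x y.
  move=> xW /connectP[p + ->]; elim: p x xW => [|z p IHp] x xW /=; first by left.
  case/andP => /and3P[_ zW /existsP[e /eqP Ee]] zp.
  apply: (@never_missed_trans _ _ z); last exact: IHp.
    apply: contrapT => no; apply: nocov; exists z => // N' N'max.
    by apply: contraT => zN'; case: no; exists N'.
  right=> N' [N'm N'max]; case: (boolP (x \in covered N')) => xN'; first by left.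
  case: (boolP (z \in covered N')) => zN'; [by right|exfalso].
  have : e \notin N'.
    by apply: contraNN xN' => eN'; apply/coveredP; exists e; rewrite // Ee !inE eqxx.
  have /N'max : matching W (e |: N').
    apply: matching_add => //; rewrite Ee; first by rewrite subUset !sub1set xW.
    by move=> v; rewrite in_set2 => /orP[] /eqP->.
  by move=> le eN'; move: le; rewrite cardsU1 eN' add1n ltnn.
pose K x := [set y in W | connect a x y].
have Kx x : x \in W -> x \in K x by move=> xW; rewrite inE xW connect0.
have /matchingP[NW N1] := proj1 Nmax.
pose X := W :\: covered N.
have K_inj : {in X &, injective K}.
  move=> x y /setDP[xW xN] /setDP[yW yN] E.
  have : y \in K x by rewrite E Kx.
  rewrite in_set yW /= => /(never _ _ xW) [//|/(_ N Nmax)] [].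
    by rewrite (negbTE xN).
  by rewrite (negbTE yN).
have K_edge x e v : ends e \subset W -> v \in ends e -> v \in K x -> ends e \subset K x.
  move=> eW ve; rewrite inE => /andP[vW xv]; apply/fintype.subsetP => w we.
  rewrite inE (fintype.subsetP eW) //=; have [->//|->] := ends_cases we ve.
  apply: connect_trans xv (connect1 _); rewrite /a /= vW (fintype.subsetP eW) ?opp_in //=.
  by apply/existsP; exists e; rewrite -(ends_opp ve).
exists finset.set0, (K @: X); split.
- exact: finset.sub0set.
- apply/trivIsetP => _ _ /imsetP[x xX ->] /imsetP[y yX ->] KK.
  rewrite -setI_eq0; apply/set0Pn => -[z /setIP[]]; rewrite !inE => /andP[zW xz] /andP[_ yz].
  case/negP: KK; apply/eqP/setP => w; rewrite !inE; congr (_ && _).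
  by rewrite (same_connect csym xz) (same_connect csym yz).
- move=> _ /imsetP[x xX ->]; split; first by apply/fintype.subsetP => y; rewrite !inE => /andP[->].
  have /setDP[xW xN] := xX.
  have even_card : #|K x :\ x| = 2 * #|[set e in N | ends e \subset K x]|.
    rewrite -double_countT -sum1_card big_mkcond /=; apply: eq_bigr => v _.
    case: ifP => [|vK].
      rewrite in_setD1 => /andP[vx vK].
      have vN : v \in covered N.
        have := vK; rewrite inE => /andP[vW /(never _ _ xW)[E|/(_ N Nmax)[]//]].
          by rewrite E eqxx in vx.
        by rewrite (negbTE xN).
      have /coveredP[e eN ve] := vN.
      suff -> : [set e in N | ends e \subset K x] :&: inc v = [set e] by rewrite cards1.
      apply/setP => f; rewrite !inE; apply/idP/eqP => [/andP[/andP[fN _] vf]|->]; first exact: N1 vf ve.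
      rewrite eN ve andbT /=; apply: K_edge ve vK.
      by apply/fintype.subsetP => w; apply: NW.
    apply/esym/eqP; rewrite cards_eq0; apply/eqP/setP => f; rewrite !inE.
    apply/negbTE/negP => /andP[/andP[fN fK] vf].
    move: vK; rewrite in_setD1 (fintype.subsetP fK) // andbT => /negbFE/eqP E.
    by case/negP: xN; apply/coveredP; exists f; rewrite -?E.
  by rewrite (cardsD1 x) Kx // even_card oddD oddM.
- by move=> _ e v /imsetP[x xX ->] eW ve vK; rewrite finset.setU0; apply: K_edge ve vK.
- rewrite cards0 addn0 card_in_imset // cardsD (setIidPr _) ?covered_sub ?(proj1 Nmax) //.
  by rewrite (card_covered (proj1 Nmax)); lia.
Qed.

(** Every edge of a bridgeless cubic graph with a 1-factor lies in a
    1-factor: an obstruction is a set [U] whose removal leaves at least [#|U|]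
    odd components, each of which sends at least three edges to [U], while the
    given edge uses up two of the [3 * #|U|] edge ends at [U]. *)
Theorem edge_in_factor M e : cubic G -> bridgeless G -> is_factor 1 M ->
  exists2 M', is_factor 1 M' & e \in M'.
Proof.
move=> G_cubic G_bridgeless M_factor; pose W := ~: ends e.
have [N Nmax] := max_matching_exists W; have Nm := proj1 Nmax.
have /matchingP[NW N1] := Nm.
have even_W : ~~ odd #|W|.
  have := cardsC (ends e); rewrite card_ends2 => E.
  have : 2 * #|M| = #|vertex G|.
    have /factorP M1 := M_factor; rewrite -double_countT (eq_bigr (fun=> 1)) => [|v _]; last exact: M1.
    by rewrite sum1_card.
  by rewrite -E /W; lia.
case: (ltnP (2 * #|N|) #|W|) => WN; last first.
  have cov : covered N = W.
    by apply/eqP; rewrite eqEcard covered_sub // (card_covered Nm).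
  exists (e |: N); last by rewrite !inE eqxx.
  apply/factorP => v; apply/eqP/cards1P.
  case: (boolP (v \in ends e)) => ve.
    exists e; apply/setP => f; rewrite !inE; apply/idP/eqP => [|->]; last by rewrite eqxx ve.
    case/andP => /orP[/eqP//|fN] vf; have := NW f v fN vf.
    by rewrite !inE ve.
  have : v \in covered N by rewrite cov inE.
  case/coveredP => f fN vf; exists f; apply/setP => h; rewrite !inE.
  apply/idP/eqP => [/andP[/orP[/eqP->|hN] vh]|->]; first by rewrite vh in ve.
    exact: N1 vh vf.
  by rewrite fN vf orbT.
have [U [P [UW Ptriv Podd Pedge card]]] := tutte_berge Nmax.
pose U' := U :|: ends e.
have U'c : #|U'| = #|U| + 2.
  rewrite /U' cardsU card_ends2 (_ : U :&: ends e = finset.set0) ?cards0 ?subn0 //.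
  apply/setP => x; rewrite !inE; apply/negbTE/negP => /andP[/(fintype.subsetP UW)].
  by rewrite inE => /negbTE->.
(* [W] has even size, so a matching that is not perfect misses two vertices. *)
have PU : #|U'| <= #|P|.
  rewrite U'c; suff : 2 * #|N| + 2 <= #|W| by lia.
  by move: WN even_W; lia.
have Q3 Q : Q \in P -> 3 <= #|cutset Q|.
  move=> QP; have [_ oQ] := Podd Q QP.
  have oc : odd #|cutset Q| by rewrite odd_cut_cubic.
  have : #|cutset Q| != 1.
    apply/cards1P => -[b Eb]; have /forallP/(_ b)/negP := G_bridgeless; apply.
    have [v0 vb0] := end_exists b.
    have [v [vb vQ oQv]] : exists v, [/\ v \in ends b, v \in Q & opp b v \notin Q].
      have : b \in cutset Q by rewrite Eb inE.
      rewrite (in_cutset _ vb0); case: (boolP (v0 \in Q)) => v0Q; case: (boolP (opp b v0 \in Q)) => o0Q // _.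
        by exists v0.
      by exists (opp b v0); rewrite opp_in ?oppK.
    rewrite /bridge negb_forall; apply/existsP; exists v; rewrite negb_imply vb /=.
    rewrite negb_forall; apply/existsP; exists (opp b v); rewrite negb_imply opp_in //=.
    move: (opp b v) oQv => w wQ; apply/negP => /connectP[p].
    elim: p v vQ {vb} => [|z p IHp] v vQ /=; first by move=> _ E; rewrite E vQ in wQ.
    case/andP => /existsP[g /andP[gb /eqP Eg]] zp; apply: IHp zp.
    have vg : v \in ends g by rewrite Eg !inE eqxx.
    have : g \notin cutset Q by move: gb; rewrite Eb !inE.
    rewrite (in_cutset _ vg) negbK vQ => /eqP oQ'.
    have : z \in ends g by rewrite Eg !inE eqxx orbT.
    by move/ends_cases => /(_ v vg) [->//|->].
  by move: oc; case: #|_| => [|[|[|]]].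
have cut_end g Q : Q \in P -> g \in cutset Q ->
    exists v, [/\ v \in ends g, v \in Q, v \notin U' & opp g v \in U'].
  move=> QP gQ; have [QWU _] := Podd Q QP.
  have [v [vg vQ oQ]] : exists v, [/\ v \in ends g, v \in Q & opp g v \notin Q].
    have [v0 vg0] := end_exists g.
    move: gQ; rewrite (in_cutset _ vg0).
    case: (boolP (v0 \in Q)) => v0Q; case: (boolP (opp g v0 \in Q)) => o0Q // _; first by exists v0.
    by exists (opp g v0); rewrite opp_in ?oppK.
  have := fintype.subsetP QWU v vQ; rewrite !inE => /andP[vU ve].
  exists v; split; rewrite // !inE ?negb_or ?vU //.
  case: (boolP (opp g v \in ends e)) => oe; rewrite ?orbT // orbF.
  have gW : ends g \subset W.
    by apply/fintype.subsetP => w wg; rewrite inE; have [->|->] := ends_cases wg vg.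
  have := fintype.subsetP (Pedge Q g v QP gW vg vQ) _ (opp_in vg).
  by rewrite inE (negbTE oQ).
have cut_count g : \sum_(Q in P) (g \in cutset Q) + 2 * (g == e) <= #|ends g :&: U'|.
  case: (eqVneq g e) => [->|ge].
    rewrite big1 => [|Q QP]; first by rewrite (setIidPl _) ?card_ends2 // finset.subsetUr.
    apply/eqP; rewrite eqb0; apply/negP => /(cut_end _ _ QP)[v [ve _]].
    by rewrite !inE ve orbT.
  rewrite muln0 addn0; case: (posnP (\sum_(Q in P) (g \in cutset Q))) => [->//|].
  rewrite lt0n sum_nat_eq0 negb_forall => /existsP[Q]; rewrite negb_imply => /andP[QP].
  rewrite eqb0 negbK => gQ; have [v [vg vQ vU' oU']] := cut_end g Q QP gQ.
  rewrite (card_endsI _ vg) (negbTE vU') oU' (bigD1 Q) //= gQ big1 // => Q' /andP[Q'P QQ'].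
  apply/eqP; rewrite eqb0; apply/negP => /(cut_end _ _ Q'P)[v' [v'g v'Q' v'U' _]].
  have [E|E] := ends_cases v'g vg; last by rewrite E oU' in v'U'.
  case/negP: QQ'; rewrite E in v'Q'.
  by rewrite -(def_pblock Ptriv Q'P v'Q') (def_pblock Ptriv QP vQ).
have total : \sum_(Q in P) #|cutset Q| + 2 <= 3 * #|U'|.
  have -> : 3 * #|U'| = \sum_g #|ends g :&: U'|.
    have := double_count [set: edge G] U'; rewrite (eq_bigr (fun=> 3)) => [|v _]; last by rewrite setTI card_inc.
    by rewrite sum_nat_const mulnC => ->; apply: eq_bigl => g; rewrite inE.
  apply: (@leq_trans (\sum_g (\sum_(Q in P) (g \in cutset Q) + 2 * (g == e)))).
    2: by apply: leq_sum => g _; apply: cut_count.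
  rewrite big_split /= leq_add //.
    rewrite exchange_big /=; apply: leq_sum => Q _.
    by rewrite -sum1_card big_mkcond /=; apply: leq_sum => g _; case: ifP.
  by rewrite (bigD1 e) //= eqxx muln1 leq_addr.
have : 3 * #|P| <= \sum_(Q in P) #|cutset Q|.
  by rewrite mulnC -sum_nat_const; apply: leq_sum => Q; apply: Q3.
by lia.
Qed.

End TutteBerge.

(** * Integral rounding and partial 3-edge-colourings *)

Section Rounding.
Local Open Scope ring_scope.
Variables (R : archiRealFieldType) (T I J : finType) (k1 : T -> I) (k2 : T -> J).
Implicit Types (F : {set T}) (t : T) (y z : T -> R).

Lemma card_blocks (K : finType) (k : T -> K) F :
    (forall t, t \in F -> exists t', [/\ t' \in F, t' != t & k t' = k t]) ->
  (2 * #|k @: F| <= #|F|)%N.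
Proof.
move=> two; rewrite mulnC -sum_nat_const -[#|F|]sum1_card (partition_big_imset k) /=.
apply: leq_sum => _ /imsetP[t tF ->]; have [t' [t'F t't kt']] := two t tF.
rewrite sum1_card -(_ : #|[set t; t']| = 2%N); last by rewrite cards2 eq_sym t't.
apply/subset_leq_card/fintype.subsetP => s; rewrite !inE => /orP[] /eqP->.
  by rewrite unfold_in tF eqxx.
by rewrite unfold_in t'F kt' eqxx.
Qed.

(** The blocks met by [F] have at least two elements in [F], so the two partitions have
    together at most [#|F|] of them. The equations are moreover dependent: those of
    either partition add up to the same sum over [F]. So there is a nonzero solution. *)
Lemma block_kernel F : F != finset.set0 ->
    (forall t, t \in F -> exists t', [/\ t' \in F, t' != t & k1 t' = k1 t]) ->
    (forall t, t \in F -> exists t', [/\ t' \in F, t' != t & k2 t' = k2 t]) ->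
  exists z, [/\ exists t, z t != 0, forall t, t \notin F -> z t = 0,
    forall i, \sum_(t | k1 t == i) z t = 0 & forall j, \sum_(t | k2 t == j) z t = 0].
Proof.
move=> F0 /card_blocks two1 /card_blocks two2.
pose B1 : 'M[R]_(#|F|, #|k1 @: F|) := \matrix_(a, i) (k1 (enum_val a) == enum_val i)%:R.
pose B2 : 'M[R]_(#|F|, #|k2 @: F|) := \matrix_(a, j) (k2 (enum_val a) == enum_val j)%:R.
pose B := row_mx B1 B2.
pose u : 'cV[R]_(#|k1 @: F| + #|k2 @: F|) := col_mx (const_mx 1) (const_mx (-1)).
have row_sum (K : finType) (k : T -> K) (a : 'I_#|F|) (c : R) :
    \sum_(i < #|k @: F|) (k (enum_val a) == enum_val i)%:R * c = c.
  have ka : k (enum_val a) \in k @: F by apply: imset_f; exact: enum_valP.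
  rewrite (bigD1 (enum_rank_in ka (k (enum_val a)))) //= enum_rankK_in // eqxx mul1r.
  rewrite big1 ?addr0 // => i /negbTE ni; case: eqP => [E|]; last by rewrite mul0r.
  by case/eqP: ni; apply: enum_val_inj; rewrite enum_rankK_in.
have Bu : B *m u = 0.
  apply/matrixP => a b; rewrite /B /u mul_row_col !mxE.
  under eq_bigr => i _ do rewrite !mxE; under [X in _ + X]eq_bigr => i _ do rewrite !mxE.
  by rewrite !row_sum subrr.
have not_full : ~~ row_full B.
  apply/row_fullP => -[B' B'B]; have : u = 0 by rewrite -[u]mul1mx -B'B -mulmxA Bu mulmx0.
  have /set0Pn[t tF] := F0; have kt : k1 t \in k1 @: F by apply: imset_f.
  move/matrixP => /(_ (lshift _ (enum_rank_in kt (k1 t))) 0).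
  by rewrite /u col_mxEu !mxE => /eqP; rewrite oner_eq0.
have not_free : ~~ row_free B.
  apply: contra not_full; rewrite -col_leq_rank /row_free => /eqP->.
  by move: two1 two2; lia.
have /rowV0Pn[v /sub_kermxP vB v0] : kermx B != 0 by rewrite kermx_eq0.
pose z t := \sum_a (enum_val a == t)%:R * v 0 a.
have sum_z (K : finType) (k : T -> K) c :
    \sum_(t | k t == c) z t = \sum_a (k (enum_val a) == c)%:R * v 0 a.
  rewrite /z exchange_big /=; apply: eq_bigr => a _; rewrite -big_distrl /=; congr (_ * _).
  rewrite big_mkcond (bigD1 (enum_val a)) //= eqxx big1 ?addr0 => [|t]; first by case: ifP.
  by rewrite eq_sym => /negbTE->; case: ifP.
have zE a : z (enum_val a) = v 0 a.
  rewrite /z (bigD1 a) //= eqxx mul1r big1 ?addr0 // => b /negbTE ba.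
  by case: eqP => [/enum_val_inj E|_]; [rewrite E eqxx in ba|rewrite mul0r].
have sum0 (K : finType) (k : T -> K) c : 
    (forall i : 'I_#|k @: F|, \sum_a (k (enum_val a) == enum_val i)%:R * v 0 a = 0) ->
    \sum_(t | k t == c) z t = 0.
  move=> H; rewrite sum_z; case: (boolP (c \in k @: F)) => cF.
    by rewrite -[RHS](H (enum_rank_in cF c)) enum_rankK_in.
  apply: big1 => a _; case: eqP => [E|_]; last by rewrite mul0r.
  by case/negP: cF; rewrite -E; apply: imset_f; exact: enum_valP.
exists z; split.
- have /rV0Pn[a va] : v != 0 by [].
  by exists (enum_val a); rewrite zE.
- move=> t tF; apply: big1 => a _; case: eqP => [E|_]; last by rewrite mul0r.
  by case/negP: tF; rewrite -E; exact: enum_valP.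
- move=> i; apply: sum0 => {}i; have /matrixP/(_ 0 (lshift _ i)) := vB.
  rewrite mul_mx_row row_mxEl !mxE => H; rewrite -[RHS]H; apply: eq_bigr => a _; by rewrite mxE mulrC.
- move=> j; apply: sum0 => {}j; have /matrixP/(_ 0 (rshift _ j)) := vB.
  rewrite mul_mx_row row_mxEr !mxE => H; rewrite -[RHS]H; apply: eq_bigr => a _; by rewrite mxE mulrC.
Qed.

(** An integral sum cannot have exactly one summand that is not an integer. *)
Lemma block_fractional (K : finType) (k : T -> K) y t :
    (forall c, \sum_(s | k s == c) y s \is a Num.int) -> y t \isn't a Num.int ->
  exists s, [/\ y s \isn't a Num.int, s != t & k s = k t].
Proof.
move=> y_int yt; apply: contrapT => none; case/negP: yt.
have := y_int (k t); rewrite (bigD1 t) //= addrC => H.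
rewrite -(addKr (\sum_(s | (k s == k t) && (s != t)) y s) (y t)) addrC.
apply: rpredB => //; apply: rpred_sum => s /andP[/eqP ks st].
by apply: contraT => ys; case: none; exists s.
Qed.

(** The edges of a bipartite multigraph with blocks as vertices: weights with integral
    sums can be rounded. Move along a solution given by [block_kernel] on the entries
    that are not integers until the first of them becomes one. *)
Theorem integral_rounding y :
    (forall i, \sum_(t | k1 t == i) y t \is a Num.int) ->
    (forall j, \sum_(t | k2 t == j) y t \is a Num.int) ->
  exists y', [/\ forall t, y' t \is a Num.int,
    forall i, \sum_(t | k1 t == i) y' t = \sum_(t | k1 t == i) y t,
    forall j, \sum_(t | k2 t == j) y' t = \sum_(t | k2 t == j) y t
  & forall t (n : int), (n%:~R <= y t -> n%:~R <= y' t) /\ (y t <= n%:~R -> y' t <= n%:~R)].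
Proof.
have [m] := ubnP #|[set t | y t \isn't a Num.int]|; elim: m y => // m IHm y.
set F := [set t | _]; move=> Fm y1 y2.
case: (eqVneq F finset.set0) => [F0|F0].
  by exists y; split=> // t; apply: contraT => yt; have := in_set0 t; rewrite -F0 inE yt.
have [||z [[t0 z0] zF z1 z2]] := @block_kernel F F0.
- by move=> t; rewrite inE => /(block_fractional y1)[s [ys st ks]]; exists s; rewrite inE.
- by move=> t; rewrite inE => /(block_fractional y2)[s [ys st ks]]; exists s; rewrite inE.
(* How far [y t] may move in the direction of [z t] before it meets an integer. *)
pose room t : R := if 0 < z t then (Num.ceil (y t))%:~R - y t else y t - (Num.floor (y t))%:~R.
pose ratio t := room t / `|z t|.
have [t1 z1_neq0 t1_min] := @arg_minP _ _ _ t0 (fun t => z t != 0) ratio z0.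
have room_ge0 t : 0 <= room t.
  by rewrite /room; case: ifP => _; rewrite subr_ge0 ?ceil_ge ?floor_le.
pose l := ratio t1; have l0 : 0 <= l by rewrite divr_ge0.
pose y' t := y t + l * z t.
have moved t : z t != 0 -> l * `|z t| <= room t.
  by move=> zt; rewrite -ler_pdivlMr ?normr_gt0 //; apply: t1_min.
have bounds t (n : int) : (n%:~R <= y t -> n%:~R <= y' t) /\ (y t <= n%:~R -> y' t <= n%:~R).
  rewrite /y'; case: (eqVneq (z t) 0) => [->|zt]; first by rewrite mulr0 addr0.
  have := moved t zt; rewrite /room; case: (ltrgt0P (z t)) (zt) => //= zt0 _ lz; split=> yn.
  - by apply: le_trans yn _; rewrite lerDl mulr_ge0 // ltW.
  - have : Num.ceil (y t) <= n by rewrite ceil_le_int.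
    by rewrite -(ler_int R) => ?; lra.
  - have : n <= Num.floor (y t) by rewrite floor_ge_int.
    rewrite -(ler_int R) => ?; rewrite mulrN in lz; lra.
  - by apply: le_trans yn; rewrite gerDl mulr_ge0_le0 // ltW.
have sum_y' (K : finType) (k : T -> K) c : \sum_(t | k t == c) z t = 0 ->
    \sum_(t | k t == c) y' t = \sum_(t | k t == c) y t.
  by move=> H; rewrite big_split /= -big_distrr /= H mulr0 addr0.
have y't1 : y' t1 \is a Num.int.
  have E : l * `|z t1| = room t1 by rewrite /l /ratio divfK // normr_eq0.
  move: E; rewrite /y' /room; case: (ltrgt0P (z t1)) (z1_neq0) => //= zt0 _ E.
    by rewrite E addrC subrK.
  by rewrite mulrN in E; rewrite -[l * _]opprK E opprB addrC subrK.
have [|||y'' [y''_int s1 s2 b]] := IHm y'.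
- rewrite ltnS in Fm; apply: leq_trans Fm; apply: (@leq_trans #|F :\ t1|.+1).
    rewrite ltnS; apply/subset_leq_card/fintype.subsetP => t; rewrite !inE.
    case: (eqVneq t t1) => [->|_] /=; first by rewrite y't1.
    apply: contra => yt; rewrite /y' zF ?mulr0 ?addr0 // inE yt //.
  have t1F : t1 \in F by apply: contraNT z1_neq0 => /zF->.
  by rewrite [#|F|](cardsD1 t1) t1F.
- by move=> i; rewrite sum_y'.
- by move=> j; rewrite sum_y'.
exists y''; split=> // [i|j|t n].
- by rewrite s1 sum_y'.
- by rewrite s2 sum_y'.
- by have [b1 b2] := bounds t n; have [b3 b4] := b t n; split=> [/b1/b3|/b2/b4].
Qed.

End Rounding.

Definition small_values : seq int := [:: 1; 2; 3; -1; -2; -3]%R.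
(** Among the values allowed, those congruent to 2 and those congruent to 1 modulo 4. *)
Definition even_value (x : int) := x \in [:: 2; -2]%R.
Definition plus_value (x : int) := x \in [:: 1; -3]%R.

Lemma small_valuesP (x : int) : ((1 <= x <= 3) || (-3 <= x <= -1))%R -> x \in small_values.
Proof. by case: x => [[|[|[|[|n]]]]|[|[|[|n]]]]. Qed.

(** If three nonzero residues modulo 4 have sum 0, one of them is 2 and the other two
    are equal and odd. *)
Lemma small_triples : all (fun x => all (fun y => all (fun z => (x + y + z == 0)%R ==>
   [&& ~~ (even_value x && even_value y), even_value x || even_value y || even_value z &
      (~~ even_value x && ~~ even_value y) ==> (plus_value x == plus_value y)])
   small_values) small_values) small_values.
Proof. by vm_compute. Qed.


Lemma plus_valueN (x : int) : x \in small_values -> ~~ even_value x ->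
  plus_value (- x)%R = ~~ plus_value x.
Proof.
have /allP H : all (fun x => ~~ even_value x ==> (plus_value (- x)%R == ~~ plus_value x)) small_values.
  by vm_compute.
by move=> /H/implyP Hx /Hx/eqP.
Qed.

Section PartialColoring.
Variables (R : realType) (G : multigraph).
Hypothesis G_cubic : cubic G.
Implicit Types (N F : {set edge G}) (e f h : edge G) (u v w : vertex G).

(** The flow is rounded after cutting the edges of [N] in two: the half-edges of [N] form
    one further block, whose sum vanishes because all the others do. *)
Lemma integral_half_flow N : has_flow (4%R : R) N -> exists k : vertex G -> edge G -> int,
  [/\ forall v, (\sum_(e in inc v) k v e = 0)%R,
      forall v e, v \in ends e -> k v e \in small_values
    & forall v e, v \in ends e -> e \notin N -> (k (opp e v) e = - k v e)%R].
Proof.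
move=> [g [g_bd g_bound g_opp]].
pose T := (vertex G * edge G)%type.
pose y (t : T) : R := (if t.1 \in ends t.2 then g t.1 t.2 else 0)%R.
pose k2 (t : T) := if t.2 \in N then None else Some t.2.
have sum1 (x : T -> R) v : (\sum_(t | t.1 == v) x t = \sum_e x (v, e))%R.
  rewrite (reindex_onto (fun e => (v, e)) snd) => [|[w e] /= /eqP->//].
  by apply: eq_bigl => e; rewrite /= !eqxx.
have y1 v : (\sum_(t | t.1 == v) y t = 0)%R.
  rewrite sum1 -[RHS](g_bd v) [RHS]big_mkcond /=; apply: eq_bigr => e _.
  by rewrite /y /= in_inc.
have sum_edge (x : T -> R) e v : v \in ends e -> (forall w, w \notin ends e -> x (w, e) = 0%R) ->
    (\sum_(t | t.2 == e) x t = x (v, e) + x (opp e v, e))%R.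
  move=> ve x0; rewrite (reindex_onto (fun w => (w, e)) fst) => [|[w f] /= /eqP->//].
  rewrite (eq_bigl xpredT) => [|w]; last by rewrite /= !eqxx.
  rewrite (bigID (mem (ends e))) /= [X in (_ + X)%R]big1 ?addr0 => [|w /x0//].
  by rewrite (ends_opp ve) big_setU1 ?big_set1 //= inE eq_sym opp_neq.
have k2_Some e : e \notin N -> (fun t : T => k2 t == Some e) =1 (fun t => t.2 == e).
  move=> eN [w f]; rewrite /k2 /=; case: ifP => fN; last by [].
  by case: (eqVneq f e) => // E; rewrite -E fN in eN.
have y2_Some e : (\sum_(t | k2 t == Some e) y t = 0)%R.
  case: (boolP (e \in N)) => eN.
    apply: big_pred0 => -[w f]; rewrite /k2 /=; case: ifP => fN //.
    by case: eqP => // -[E]; rewrite E eN in fN.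
  rewrite (eq_bigl _ _ (k2_Some e eN)); have [v ve] := end_exists e.
  rewrite (sum_edge y e v ve) => [|w /negbTE we]; last by rewrite /y /= we.
  by rewrite /y /= ve opp_in // g_opp // (negbTE eN) subrr.
have y2_None : (\sum_(t | k2 t == None) y t = 0)%R.
  have : (\sum_t y t = 0)%R by rewrite (partition_big fst xpredT) //=; apply: big1 => v _; apply: y1.
  rewrite (partition_big k2 xpredT) //= (bigD1 None) //= [X in (_ + X)%R]big1 ?addr0 //.
  by case=> // e _; apply: y2_Some.
have int0 : (0%R : R) \is a Num.int by apply: rpred0.
have [||y' [y'_int s1 s2 b]] := @integral_rounding R T _ _ fst k2 y.
- by move=> v; rewrite y1.
- by case=> [e|]; rewrite ?y2_Some ?y2_None.
have yk t : y' t = ((Num.floor (y' t))%:~R)%R.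
  by have := y'_int t; rewrite intrEfloor => /eqP.
have y'0 w e : w \notin ends e -> y' (w, e) = 0%R.
  move=> /negbTE we; have y0 : y (w, e) = 0%R by rewrite /y /= we.
  have [b1 b2] := b (w, e) 0; apply/eqP; rewrite eq_le.
  by rewrite b1 ?b2 // y0.
exists (fun v e => Num.floor (y' (v, e))); split=> [v|v e ve|v e ve eN].
- apply: (@intr_inj R); rewrite rmorph_sum /= -[RHS](y1 v) -s1 sum1 [LHS]big_mkcond /=.
  apply: eq_bigr => e _; rewrite in_inc; case: ifP => [_|/negbT/y'0->//].
  by rewrite -yk.
- have := g_bound v e ve; rewrite -[g v e]/(g (v, e).1 (v, e).2).
  have E : y (v, e) = g (v, e).1 (v, e).2 by rewrite /y /= ve.
  rewrite -E; have [lo3 up3] := b (v, e) 3; have [lo1 up1] := b (v, e) 1.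
  have [lom3 _] := b (v, e) (-3)%R; have [_ upm1] := b (v, e) (-1)%R.
  rewrite yk in lo3 up3 lo1 up1 lom3 upm1; rewrite !ler_int in lo3 up3 lo1 up1 lom3 upm1.
  move: (Num.floor _) lo3 up3 lo1 up1 lom3 upm1 => k lo3 up3 lo1 up1 lom3 upm1.
  have e41 : (4 - 1 = 3 :> R)%R by lra.
  rewrite e41 ler_norml ler_normr => /andP[/orP[y_ge1|y_le1] /andP[ym3 y3]].
    by apply: small_valuesP; rewrite lo1 // up3.
  apply: small_valuesP; rewrite lom3 ?upm1 ?orbT //; rewrite mulrN1z; lra.
- have := s2 (Some e); rewrite y2_Some (eq_bigl _ _ (k2_Some e eN)).
  rewrite (sum_edge y' e v ve) => [H|w]; last exact: y'0.
  apply: (@intr_inj R); rewrite rmorphN /= -!yk; apply/eqP.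
  by rewrite -addr_eq0 addrC H.
Qed.

(** The edges of even value are the first colour class. The edges of odd value have
    degree 2, and the residue modulo 4 is constant at a vertex and changes along
    an edge outside [N], so they form a bipartite graph, with sides given by [A]. *)
Lemma flow_partial_coloring N : has_flow (4%R : R) N ->
  exists c : edge G -> 'I_3, forall v e f, e \notin N -> f \notin N ->
    v \in ends e -> v \in ends f -> e != f -> c e != c f.
Proof.
case/integral_half_flow => k [k_bd k_small k_opp].
have triple v e f h : [/\ e != f, e != h, f != h & inc v = [set e; f; h]] ->
    [&& ~~ (even_value (k v e) && even_value (k v f)),
        even_value (k v e) || even_value (k v f) || even_value (k v h) &
      (~~ even_value (k v e) && ~~ even_value (k v f)) ==>
        (plus_value (k v e) == plus_value (k v f))].
  move=> [ef eh fh Ev]; have vin x : x \in [set e; f; h] -> k v x \in small_values.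
    by rewrite -Ev in_inc; apply: k_small.
  have /allP/(_ (k v e)) := small_triples; rewrite vin ?inE ?eqxx // => /(_ isT).
  move=> /allP/(_ (k v f)); rewrite vin ?inE ?eqxx ?orbT // => /(_ isT).
  move=> /allP/(_ (k v h)); rewrite vin ?inE ?eqxx ?orbT // => /(_ isT) /implyP; apply.
  have := k_bd v; rewrite Ev -setUA big_setU1 ?inE ?negb_or ?ef ?eh //=.
  by rewrite big_setU1 ?big_set1 ?inE ?fh //= addrA => ->.
have pair v e f : v \in ends e -> v \in ends f -> e != f ->
    ~~ (even_value (k v e) && even_value (k v f)) /\
    (~~ even_value (k v e) -> ~~ even_value (k v f) -> plus_value (k v e) = plus_value (k v f)).
  move=> ve vf ef; have [h [h' H]] := inc_split G_cubic ve.
  have [x Hx] : exists x, [/\ e != f, e != x, f != x & inc v = [set e; f; x]].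
    case: H => eh eh' hh' Ev; have : f \in inc v by rewrite in_inc.
    rewrite Ev !inE eq_sym (negbTE ef) /= => /orP[] /eqP ->; first by exists h'.
    by exists h; split=> //; [rewrite eq_sym | rewrite setUAC].
  have /and3P[-> _ /implyP H'] := triple v e f x Hx; split=> // e1 f1.
  by apply/eqP/H'; rewrite e1.
pose ev e := [exists v in ends e, even_value (k v e)].
have even_opp (x : int) : even_value (- x)%R = even_value x.
  by rewrite /even_value !inE -[in LHS](opprK 2%R) !eqr_opp orbC.
have evE e v : e \notin N -> v \in ends e -> ev e = even_value (k v e).
  move=> eN ve; apply/existsP/idP => [[u /andP[ue]]|H]; last by exists v; rewrite ve.
  by have [->//|->] := ends_cases ue ve; rewrite k_opp // even_opp.
pose A := [set v | [exists e in inc v, ~~ even_value (k v e) && plus_value (k v e)]].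
have AE v e : v \in ends e -> ~~ even_value (k v e) -> (v \in A) = plus_value (k v e).
  move=> ve e1; rewrite inE; apply/existsP/idP => [[f /and3P[vf f1 fp]]|H].
    rewrite in_inc in vf; case: (eqVneq e f) => [->//|ef].
    by have [_ ->] := pair v e f ve vf ef.
  by exists e; rewrite in_inc ve e1.
pose F := [set e in ~: N | ~~ ev e].
have F_cut : F \subset cutset A.
  apply/fintype.subsetP => e; rewrite inE => /andP[]; rewrite inE => eN eo.
  have [v ve] := end_exists e; rewrite (in_cutset _ ve).
  have e1 : ~~ even_value (k v e) by rewrite -(evE e v).
  have e2 : ~~ even_value (k (opp e v) e) by rewrite -(evE e) ?opp_in.
  rewrite (AE v e) // (AE _ e) ?opp_in // k_opp //.
  by rewrite plus_valueN ?k_small //; case: (plus_value _).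
have F2 v : #|F :&: inc v| <= 2.
  have [e ve] : exists e, v \in ends e.
    have /card_gt0P[e] : 0 < #|inc v| by rewrite card_inc.
    by rewrite in_inc; exists e.
  have [f [h H]] := inc_split G_cubic ve; have /and3P[_ some_even _] := triple _ _ _ _ H.
  have sub x : even_value (k v x) -> x \in inc v -> F :&: inc v \subset inc v :\ x.
    move=> xe; rewrite in_inc => vx; apply/fintype.subsetP => y; rewrite 3!inE => /andP[/andP[yN yo] yv].
    rewrite in_setD1 yv andbT; apply: contraNneq yo => ->.
    by apply/existsP; exists v; rewrite vx.
  have card2 x : x \in inc v -> #|inc v :\ x| = 2.
    by move=> xv; have := card_inc G_cubic v; rewrite (cardsD1 x) xv add1n => -[].
  case: H => _ _ _ Ev; move: some_even => /orP[/orP[]|] /sub H;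
  (have xv := H _; apply: leq_trans (subset_leq_card (H _)) _; rewrite ?card2 //);
  by rewrite Ev !inE eqxx ?orbT.
have [c c_alt] := bipartite_two_coloring F_cut F2.
exists (fun e => if ev e then ord0 else if c e then inord 1 else inord 2).
move=> v e f eN fN ve vf ef.
case: (boolP (ev e)) => ee; case: (boolP (ev f)) => fe.
- have [] := pair v e f ve vf ef; by rewrite -!evE // ee fe.
- by case: ifP => _; rewrite -val_eqE /= inordK.
- by case: ifP => _; rewrite -val_eqE /= inordK.
- rewrite (c_alt v e f) ?inE ?eN ?fN //; by case: (c e); rewrite -val_eqE /= !inordK.
Qed.

End PartialColoring.

(** * Kempe exchange and resistance *)

Lemma bigminn_le (I : finType) (P : pred I) (F : I -> nat) k i : P i ->
  \big[minn/k]_(j | P j) F j <= F i.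
Proof.
move=> Pi; have : i \in index_enum I by exact: mem_index_enum.
elim: (index_enum I) => // j s IHs; rewrite inE big_cons => /orP[/eqP<-|/IHs le].
  by rewrite Pi geq_minl.
by case: ifP => // _; apply: leq_trans (geq_minr _ _) le.
Qed.

Lemma leq_bigminn (I : finType) (P : pred I) (F : I -> nat) k m : m <= k ->
  (forall i, P i -> m <= F i) -> m <= \big[minn/k]_(j | P j) F j.
Proof.
by move=> mk mF; apply: (big_ind (fun x => m <= x)) => // x y mx my; rewrite leq_min mx.
Qed.

Section Connected.
Variable G : multigraph.
Implicit Types (K : {set edge G}) (S D : {set vertex G}) (v x y : vertex G).

Definition component K v : {set vertex G} := [set x | connect (adj K) v x].

Lemma component_edge K v e x : e \in K -> x \in ends e -> x \in component K v ->
  ends e \subset component K v.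
Proof.
move=> eK xe; rewrite inE => vx; apply/fintype.subsetP => y ye; rewrite inE.
have [->//|->] := ends_cases ye xe; apply: connect_trans vx (connect1 _).
by apply/existsP; exists e; rewrite eK -(ends_opp xe) eqxx.
Qed.

(** Grow a set of vertices from [v], one edge at a time. *)
Lemma component_card K v :
  #|component K v| <= #|[set e in K | ends e \subset component K v]|.+1.
Proof.
set D := component K v.
pose good S := [&& v \in S, S \subset D & #|S| <= #|[set e in K | ends e \subset S]|.+1].
have good1 : good [set v].
  by rewrite /good set11 cards1 sub1set inE connect0.
have [S /and3P[vS SD Scard] Smax] := arg_maxnP (fun S => #|S|) good1.
case: (eqVneq S D) => [<-//|neSD].
have [e [x [eK xe xS oS]]] : exists e, exists x, [/\ e \in K, x \in ends e, x \in S & opp e x \notin S].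
  apply: contrapT => none; case/negP: neSD; rewrite eqEsubset SD; apply/fintype.subsetP => y.
  rewrite inE => /connectP[p + ->].
  elim: p (v : vertex G) vS => [|z p IHp] w wS //=.
  case/andP => /existsP[e /andP[eK /eqP Ee]]; apply: IHp.
  apply: contrapT => /negP zS; apply: none; exists e, w.
  have we : w \in ends e by rewrite Ee !inE eqxx.
  split=> //; have : z \in ends e by rewrite Ee !inE eqxx orbT.
  by move/ends_cases => /(_ w we) [zw|<-//]; rewrite zw wS in zS.
have /Smax : good (opp e x |: S).
  have oD : opp e x \in D.
    by apply: (fintype.subsetP (component_edge eK xe _)); rewrite ?opp_in // (fintype.subsetP SD).
  rewrite /good !inE vS orbT subUset sub1set oD SD cardsU1 oS add1n ltnS /=.
  apply: leq_trans Scard _; apply: proper_card; rewrite properE; apply/andP; split.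
    apply/fintype.subsetP => f; rewrite !inE => /andP[-> fS] /=.
    by apply: subset_trans fS _; apply: subsetUr.
  apply/fintype.subsetPn; exists e; rewrite !inE eK /=.
    by rewrite (ends_opp xe) subUset !sub1set !inE eqxx xS orbT.
  by apply/negP => /fintype.subsetP/(_ _ (opp_in xe)); rewrite (negbTE oS).
by rewrite cardsU1 oS add1n /geq /= ltnn.
Qed.

Lemma component_degrees K v :
  \sum_(x in component K v) #|K :&: inc x| = 2 * #|[set e in K | ends e \subset component K v]|.
Proof.
rewrite double_count mulnC -sum_nat_const big_mkcond [RHS]big_mkcond /=; apply: eq_bigr => e _.
rewrite inE; case: (boolP (e \in K)) => //= eK; case: ifP => [/setIidPl->|eD]; first exact: card_ends2.
apply/eqP; rewrite cards_eq0; apply/eqP/setP => x; rewrite !inE; apply/andP => -[xe vx].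
by case/negP: (negbT eD); apply: component_edge eK xe _; rewrite inE.
Qed.

End Connected.

Section Kempe.
Variable G : multigraph.
Hypothesis G_cubic : cubic G.
Implicit Types (c : {ffun edge G -> 'I_4}) (e f g h : edge G) (v w x y : vertex G) (i j : 'I_4).

(** In a partial 3-edge-colouring the colour [ord_max] marks uncoloured edges. *)
Local Notation un := (ord_max : 'I_4).

Definition partial_coloring c : Prop := forall v e f,
  c e != un -> v \in ends e -> v \in ends f -> e != f -> c e != c f.

Definition uncolored c : {set edge G} := [set e | c e == un].

Definition missing c x : {set 'I_4} := [set i | (i != un) && [forall f in inc x, c f != i]].

Lemma missingP c x i : reflect (i != un /\ forall f, x \in ends f -> c f != i) (i \in missing c x).
Proof.
rewrite inE; apply: (iffP andP) => [[iu /forallP H]|[iu H]]; split=> //.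
  by move=> f xf; have := H f; rewrite in_inc xf.
by apply/forallP => f; apply/implyP; rewrite in_inc; apply: H.
Qed.

Lemma color_one c e i : partial_coloring c -> c e = un -> i != un ->
    (forall x f, x \in ends e -> x \in ends f -> c f != i) ->
  exists c', partial_coloring c' /\ #|uncolored c'| < #|uncolored c|.
Proof.
move=> cP ce iu ei; exists [ffun f => if f == e then i else c f]; split.
  move=> v f h; rewrite !ffunE; case: (eqVneq f e) => [->|fe]; case: (eqVneq h e) => [->|he].
  - by rewrite eqxx.
  - by move=> _ ve vh _; rewrite eq_sym; apply: ei vh.
  - by move=> _ vf ve _; apply: ei vf.
  - exact: cP.
apply: proper_card; apply/properP; split; last first.
  by exists e; rewrite !inE ?ce ?ffunE eqxx.
apply/fintype.subsetP => f; rewrite !inE ffunE; case: (eqVneq f e) => [->|//].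
by rewrite (negbTE iu).
Qed.

(** Three colours are available, and at most [3 - k] of them occur at a vertex with
    [k] uncoloured edges. *)
Lemma card_missing c x (S : {set edge G}) k : S \subset inc x ->
    (forall e, e \in S -> c e = un) -> #|S| = k ->
  k <= #|missing c x|.
Proof.
move=> Sx Sun Sk.
have card3 : #|[set i : 'I_4 | i != un]| = 3.
  have -> : [set i : 'I_4 | i != un] = ~: [set un] by apply/setP => i; rewrite !inE.
  by have := cardsC [set un]; rewrite cards1 card_ord add1n => -[].
have rest : #|inc x :\: S| = 3 - k.
  by rewrite -(card_inc G_cubic x) -(cardsID S (inc x)) (setIidPr Sx) Sk addKn.
have : [set i : 'I_4 | i != un] \subset missing c x :|: c @: (inc x :\: S).
  apply/fintype.subsetP => i; rewrite inE => iu; rewrite inE.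
  case: (boolP (i \in missing c x)) => //= /missingP miss.
  have [f [xf cf]] : exists f, x \in ends f /\ c f = i.
    apply: contrapT => none; apply: miss; split=> // f xf; apply/eqP => cf.
    by apply: none; exists f.
  apply/imsetP; exists f; rewrite // !inE xf andbT; apply: contra iu => fS.
  by rewrite -cf Sun.
move/subset_leq_card; rewrite card3 => le3.
have := leq_trans le3 (leq_card_setU _ _); have := leq_imset_card c (inc x :\: S).
rewrite rest; have : k <= 3 by rewrite -Sk -(card_inc G_cubic x) subset_leq_card.
have arith m a : k <= 3 -> a <= 3 - k -> 2 < m + a -> k <= m by clear; lia.
exact: arith.
Qed.

(** Kempe exchange. Two adjacent uncoloured edges [v u1] and [v u2] leave at least two
    colours missing at [v]. If none of them is missing at [u1] or [u2], the same third
    colour is missing at both ends; the two-coloured component of [v] is a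
    path starting at [v], so it avoids one of [u1], [u2]. *)
Lemma kempe_exchange c v e1 e2 : partial_coloring c -> c e1 = un -> c e2 = un ->
    v \in ends e1 -> v \in ends e2 -> e1 != e2 ->
  exists c', partial_coloring c' /\ #|uncolored c'| < #|uncolored c|.
Proof.
move=> cP c1 c2 v1 v2 e12.
have miss_v : 2 <= #|missing c v|.
  apply: (@card_missing c v [set e1; e2]); last by rewrite cards2 e12.
    by apply/fintype.subsetP => e; rewrite in_inc !inE => /orP[] /eqP->.
  by move=> e; rewrite !inE => /orP[] /eqP->.
have miss_end e x : c e = un -> x \in ends e -> 1 <= #|missing c x|.
  move=> ce xe; apply: (@card_missing c x [set e]); last by rewrite cards1.
    by rewrite sub1set in_inc.
  by move=> f; rewrite inE => /eqP->.
have common e i : c e = un -> v \in ends e -> i \in missing c v -> i \in missing c (opp e v) ->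
    exists c', partial_coloring c' /\ #|uncolored c'| < #|uncolored c|.
  move=> ce ve /missingP[iu iv] /missingP[_ io]; apply: (color_one cP ce iu) => x f xe.
  by have [->|->] := ends_cases xe ve; [apply: iv|apply: io].
have third e : c e = un -> v \in ends e ->
    (exists c', partial_coloring c' /\ #|uncolored c'| < #|uncolored c|) \/
    exists i, missing c (opp e v) = [set i] /\ missing c v = [set j | (j != un) && (j != i)].
  move=> ce ve; case: (set_0Vmem (missing c v :&: missing c (opp e v))) => [dis|[i /setIP[iv io]]].
    right; have := miss_end e _ ce (opp_in ve); rewrite card_gt0 => /set0Pn[i io].
    have sub : missing c v \subset [set j | (j != un) && (j != i)].
      apply/fintype.subsetP => j jv; have /missingP[ju _] := jv; rewrite inE ju /=.
      by apply/eqP => ji; have := in_set0 i; rewrite -dis inE io -ji jv.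
    have iu : i != un by have /missingP[] := io.
    have card2 : #|[set j : 'I_4 | (j != un) && (j != i)]| = 2.
      have -> : [set j : 'I_4 | (j != un) && (j != i)] = ~: [set un; i].
        by apply/setP => j; rewrite !inE negb_or.
      by have := cardsC [set un; i]; rewrite cards2 eq_sym iu card_ord add2n => -[].
    have Ev : missing c v = [set j | (j != un) && (j != i)].
      by apply/eqP; rewrite eqEcard sub card2.
    exists i; split=> //; apply/eqP; rewrite eq_sym eqEsubset sub1set io /=.
    apply/fintype.subsetP => j jo; have /missingP[ju _] := jo; rewrite inE; apply: contraT => ji.
    by have := in_set0 j; rewrite -dis inE jo Ev inE ju ji.
  by left; apply: common iv io.
have [//|[i [m1 mv]]] := third e1 c1 v1.
have [//|[i' [m2 mv']]] := third e2 c2 v2.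
have {i' m2 mv'} m2 : missing c (opp e2 v) = [set i].
  rewrite m2; congr [set _]; have : i' \in missing c (opp e2 v) by rewrite m2 inE.
  case/missingP => i'u _; have := congr1 (fun S : {set 'I_4} => i' \in S) mv.
  rewrite mv' !inE i'u eqxx /=.
  by move/esym/negbFE/eqP.
set u1 := opp e1 v in m1; set u2 := opp e2 v in m2.
have u1e : u1 \in ends e1 := opp_in v1; have u2e : u2 \in ends e2 := opp_in v2.
have iu : i != un by have /missingP[] : i \in missing c u1 by rewrite m1 inE.
have [a av] : exists a, a \in missing c v by apply/card_gt0P; apply: leq_trans miss_v.
have [b bv ba] : exists2 b, b \in missing c v & b != a.
  have /card_gt0P[b] : 0 < #|missing c v :\ a| by move: miss_v; rewrite (cardsD1 a) av.
  by rewrite in_setD1 => /andP[ba bv]; exists b.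
have /andP[au ai] : (a != un) && (a != i) by move: av; rewrite mv inE.
have /andP[bu bi] : (b != un) && (b != i) by move: bv; rewrite mv inE.
have present x j : j != un -> j \notin missing c x -> exists2 f, x \in ends f & c f = j.
  move=> ju /missingP nm; apply: contrapT => none; apply: nm; split=> // f xf.
  by apply/eqP => cf; apply: none; exists f.
have uniq_color x f h : x \in ends f -> x \in ends h -> c f = c h -> c f != un -> f = h.
  by move=> xf xh cfh cf; apply/eqP; apply: contraT => fh; have := cP x f h cf xf xh fh; rewrite cfh eqxx.
pose K := [set e | (c e == a) || (c e == i)].
have K_colored e : e \in K -> c e != un by rewrite inE => /orP[] /eqP->.
have degree_one x j j' : [set j; j'] = [set a; i] -> j \in missing c x ->
    #|K :&: inc x| <= 1.
  move=> jj /missingP[_ jx]; apply/card_le1_eqP => f h.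
  have col g : g \in K :&: inc x -> x \in ends g /\ c g = j'.
    rewrite inE => /andP[gK]; rewrite in_inc => xg; split=> //.
    have : c g \in [set j; j'] by rewrite jj !inE; move: gK; rewrite inE.
    by rewrite !inE (negbTE (jx g xg)) /= => /eqP.
  move=> fK hK; have [xf cf] := col f fK; have [xh ch] := col h hK.
  apply: (uniq_color x h f xh xf); first by rewrite cf ch.
  by apply: K_colored; case/setIP: hK.
have degree_v : #|K :&: inc v| <= 1 by apply: (degree_one v a i).
have degree_u x : missing c x = [set i] -> #|K :&: inc x| <= 1.
  by move=> mx; apply: (degree_one x i a); rewrite ?mx ?inE // setUC.
have degree_two x : #|K :&: inc x| <= 2.
  rewrite -(_ : #|[set a; i]| = 2); last by rewrite cards2 ai.
  rewrite -(@card_in_imset _ _ c).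
    by apply/subset_leq_card/fintype.subsetP => _ /imsetP[f /setIP[fK _] ->]; move: fK; rewrite !inE.
  move=> f h /setIP[fK]; rewrite in_inc => xf /setIP[hK]; rewrite in_inc => xh cfh.
  by apply: (uniq_color x) => //; apply: K_colored.
have u12 : u1 != u2.
  apply/eqP => E.
  have [f f1 cf] : exists2 f, u1 \in ends f & c f = a by apply: present; rewrite // m1 inE.
  have [h h1 ch] : exists2 h, u1 \in ends h & c h = b by apply: present; rewrite // m1 inE.
  have : #|[set e1; e2] :|: [set f; h]| <= #|inc u1|.
    apply/subset_leq_card/fintype.subsetP => y; rewrite in_inc !inE.
    by move=> /orP[] /orP[] /eqP-> //; rewrite E.
  rewrite (card_inc G_cubic) cardsU !cards2 e12 (_ : f != h); last first.
    by apply: contraNneq ba => fh; rewrite -ch -fh cf.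
  rewrite (_ : _ :&: _ = finset.set0) ?cards0 //; apply/setP => y; rewrite !inE.
  apply/negbTE/negP => /andP[/orP[] /eqP-> /orP[] /eqP y'];
  by [move: au; rewrite -cf -y' ?c1 ?c2 eqxx | move: bu; rewrite -ch -y' ?c1 ?c2 eqxx].
pose D := component K v.
have vD : v \in D by rewrite inE connect0.
have [e [ce ve oD mo]] : exists e, [/\ c e = un, v \in ends e, opp e v \notin D & missing c (opp e v) = [set i]].
  case: (boolP (u1 \in D)) => u1D; last by exists e1.
  case: (boolP (u2 \in D)) => u2D; last by exists e2.
  exfalso; have := component_degrees K v; have := component_card K v; rewrite -/D.
  set m := #|[set _ in _ | _]| => le1 sumE.
  have : \sum_(x in D) #|K :&: inc x| + 3 <= 2 * #|D|.
    rewrite mulnC -sum_nat_const.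
    have split3 (F : vertex G -> nat) :
        \sum_(x in D) F x = F v + (F u1 + (F u2 + \sum_(x in D | (x != v) && (x != u1) && (x != u2)) F x)).
      rewrite (bigD1 v) //= (bigD1 u1) /=; last by rewrite u1D opp_neq.
      rewrite (bigD1 u2) /=; last by rewrite u2D opp_neq // eq_sym.
      by congr (_ + (_ + (_ + _))); apply: eq_bigl => x; rewrite -!andbA.
    rewrite !split3.
    have : \sum_(x in D | (x != v) && (x != u1) && (x != u2)) #|K :&: inc x| <=
           \sum_(x in D | (x != v) && (x != u1) && (x != u2)) 2 by apply: leq_sum.
    have := degree_u u1 m1; have := degree_u u2 m2; move: degree_v; clear; lia.
  by rewrite sumE; move: le1; clear; lia.
pose KD := [set g in K | ends g \subset D].
have in_KD g x : g \in K -> x \in ends g -> x \in D -> g \in KD.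
  by move=> gK xg xD; rewrite inE gK; apply: component_edge xg xD.
have KD_in g x : g \in KD -> x \in ends g -> x \in D.
  by rewrite inE => /andP[_ /fintype.subsetP]; apply.
have KD_K g : g \in KD -> g \in K by rewrite inE => /andP[].
pose c' := [ffun g => if g \in KD then tperm a i (c g) else c g].
have tpermK g : g \in KD -> tperm a i (c g) \in [set a; i].
  by move=> /KD_K; rewrite !inE => /orP[] /eqP->; rewrite ?tpermL ?tpermR eqxx ?orbT.
have c'un g : (c' g == un) = (c g == un).
  rewrite ffunE; case: ifP => // gKD; rewrite (negbTE (K_colored _ (KD_K _ gKD))).
  by have := tpermK g gKD; rewrite !inE => /orP[] /eqP->; apply/negbTE.
have c'P : partial_coloring c'.
  move=> x f h; rewrite c'un => cf xf xh fh; have cfh := cP x f h cf xf xh fh.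
  have mixed g g' : x \in ends g -> x \in ends g' -> g \in KD -> g' \notin KD -> tperm a i (c g) != c g'.
    move=> xg xg' gKD g'KD; apply: contraNneq g'KD => E.
    apply: (in_KD g' x) => //; last exact: KD_in xg.
    by have := tpermK g gKD; rewrite E !inE.
  rewrite !ffunE; case: ifP => fKD; case: ifP => hKD.
  - by apply: contraNneq cfh => /perm_inj->.
  - by apply: mixed; rewrite ?hKD.
  - by rewrite eq_sym; apply: mixed; rewrite ?fKD.
  - exact: cfh.
have c'e : c' e = un by apply/eqP; rewrite c'un ce.
have [c'' [c''P lt]] : exists c'', partial_coloring c'' /\ #|uncolored c''| < #|uncolored c'|.
  apply: (color_one c'P c'e iu) => x f xe xf; rewrite ffunE; case: ifP => fKD.
    have xv : x = v.
      have [//|xo] := ends_cases xe ve.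
      by have := KD_in f x fKD xf; rewrite xo (negbTE oD).
    rewrite xv in xf; have /missingP[_ /(_ f xf) cfa] := av.
    have := KD_K f fKD; rewrite inE (negbTE cfa) /= => /eqP->.
    by rewrite tpermR.
  have [xv|xo] := ends_cases xe ve.
    rewrite xv in xf; apply: contraFneq fKD => cf.
    by apply: (in_KD f v) => //; rewrite inE cf eqxx orbT.
  have /missingP[_ H] : i \in missing c (opp e v) by rewrite mo inE.
  by apply: H; rewrite -xo.
exists c''; split=> //; suff -> : uncolored c = uncolored c' by [].
by apply/setP => g; rewrite !inE c'un.
Qed.

Lemma resistance_partial c : partial_coloring c -> resistance G <= #|uncolored c|.
Proof.
have [m] := ubnP #|uncolored c|; elim: m c => // m IHm c cm cP.
case: (boolP (proper_edge_coloring c)) => [c_proper|].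
  apply: leq_trans (bigminn_le _ _ c_proper) _.
  exact: (bigminn_le (P := xpredT) (fun i => #|[set e | c e == i]|) _ (i := un)).
rewrite /proper_edge_coloring negb_forall => /existsP[e1]; rewrite negb_forall => /existsP[e2].
rewrite negb_imply negbK => /andP[/andP[e12 /set0Pn[v /setIP[v1 v2]]] /eqP c12].
have c1 : c e1 = un.
  by apply/eqP; apply: contraT => ce; have := cP v e1 e2 ce v1 v2 e12; rewrite c12 eqxx.
have [c' [c'P lt]] := kempe_exchange cP c1 (etrans (esym c12) c1) v1 v2 e12.
apply: leq_trans (ltnW lt); apply: IHm => //.
by apply: leq_trans lt _.
Qed.

Lemma resistance_le (R : realType) (N : {set edge G}) :
  has_flow (4%R : R) N -> resistance G <= #|N|.
Proof.
move=> /(flow_partial_coloring G_cubic)[c cP].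
pose c' := [ffun e => if e \in N then un else widen_ord (isT : 3 <= 4) (c e)].
have c'un e : (c' e == un) = (e \in N).
  rewrite ffunE; case: ifP => // _; apply/negbTE/eqP => /(congr1 val) /= E.
  by have := ltn_ord (c e); rewrite E.
have -> : N = uncolored c' by apply/setP => e; rewrite inE c'un.
apply: resistance_partial => v e f; rewrite c'un => eN ve vf ef.
case: (boolP (f \in N)) => fN; first by move: fN; rewrite -c'un => /eqP->; rewrite c'un.
rewrite !ffunE (negbTE eN) (negbTE fN) -val_eqE /= val_eqE.
exact: cP ve vf ef.
Qed.

End Kempe.

(** * Oddness and the smallest minimal sets *)

Section Oddness.
Variable G : multigraph.
Implicit Types (X F C : {set edge G}).

(** A circuit inside a cut is even, because its degrees are even on either side. *)
Lemma odd_circuit_meets_cocut C X : is_circuit C -> odd #|C| -> cocut X ->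
  exists e, e \in X :&: C.
Proof.
move=> C_circ oC [A ->]; apply/set0Pn; apply: contraTneq oC => disj.
have -> : C = C :&: cutset A.
  by apply/esym/setIidPl; rewrite -[cutset A]setCK -disjoints_subset -setI_eq0 setIC disj.
rewrite odd_cut -dvdn2; apply: dvdn_sum => v _.
by have := circuit_degree v C_circ; rewrite !inE => /orP[] /eqP->.
Qed.

Lemma odd_circuits_cocut F X : is_factor 2 F -> cocut X -> odd_circuits F <= #|X :&: F|.
Proof.
move=> F_factor X_cocut; have /factorP F2 := F_factor.
have [s [s_v s_e]] := half_edge_signs (fun v => subsetIr F (inc v)) (fun v => eq_leq (F2 v)).
apply: leq_trans (leq_imset_card (circ F s) _); apply/subset_leq_card/fintype.subsetP => C.
rewrite inE => /and3P[CF C_circ oC].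
have [e /setIP[eX eC]] := odd_circuit_meets_cocut C_circ oC X_cocut.
apply/imsetP; exists e; first by rewrite inE eX (fintype.subsetP CF).
exact: circuit_circ eC.
Qed.

Lemma oddness_le_cocut M X : cubic G -> is_factor 1 M -> cocut X -> oddness G <= #|X :\: M|.
Proof.
move=> G_cubic M_factor X_cocut; have F_factor := factorC G_cubic M_factor isT.
apply: leq_trans (bigminn_le _ _ F_factor) _.
by rewrite setDE; apply: odd_circuits_cocut.
Qed.

Lemma leq_oddness (R : realType) m : cubic G -> ~~ edge_colorable G 3 -> m <= #|edge G| ->
    (forall N : {set edge G}, has_flow (4%R : R) N -> ~ cocut N -> m <= #|N|) ->
  m <= oddness G.
Proof.
move=> G_cubic nc mE mN; apply: leq_bigminn => // F F_factor.
have /factorP F2 := F_factor.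
have [s [s_v s_e]] := half_edge_signs (fun v => subsetIr F (inc v)) (fun v => eq_leq (F2 v)).
have [N [Nf Nc Ncard]] := broken_not_cocut R G_cubic F_factor s_v s_e nc.
exact: leq_trans (mN N Nf Nc) Ncard.
Qed.

End Oddness.

Local Open Scope ring_scope.

(* [not_copies]: for connected nonempty G this says exactly that G is not K23.
   The empty graph (n = 0) and disjoint unions of several copies of K23 are
   excluded too, because the former has no 3-minimal set and the latter have
   no 4-minimal set. *)
Theorem theorem6p10 (R : realType) (G : multigraph)
    (G_cubic : cubic G)
    (G_factor : exists M : {set edge G}, is_factor 1 M)
    (not_copies : forall n : nat, ~ isomorphic G (copies n K23)) :
  (exists X3 : {set edge G}, is_smallest_minimal (3 : R) X3) /\
  (exists X4 : {set edge G}, is_smallest_minimal (4 : R) X4) /\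
  (forall X3 X4 : {set edge G},
    is_smallest_minimal (3 : R) X3 -> is_smallest_minimal (4 : R) X4 ->
    let n : R := #|vertex G|%:R in
    let alpha : R := (independence_number G)%:R in
    [/\ bipartite G -> #|X3| = 0%N /\ #|X4| = 2%N,
        edge_colorable G 3 -> ~~ bipartite G ->
          [/\ (2 <= #|X3|)%N, #|X3|%:R <= 3 * (2^-1 * n - alpha)
            & #|X4| = 0%N],
        ~~ edge_colorable G 3 ->
          [/\ (resistance G <= #|X4|)%N, (#|X4| <= oddness G)%N,
              (oddness G <= #|X3|)%N
            & #|X3|%:R <= Num.min (3 * (2^-1 * n - alpha)) (2^-1 * n)]
      & snark G ->
          [/\ (resistance G <= #|X4|)%N, (#|X4| <= oddness G)%N,
              (oddness G < #|X3|)%N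
            & #|X3|%:R <= Num.min (3 * (2^-1 * n - alpha)) (2^-1 * n)]]).
Proof.
have [M M_factor] := G_factor.
have [v [a [b [va vb ab]]]] : exists v (a b : edge G),
    [/\ v \in ends a, v \in ends b & ends a != ends b].
  apply: contrapT => all_par; have [v a b va vb|n] := parallel_copies G_cubic.
    by apply/eqP; apply: contraT => ab; case: all_par; exists v, a, b.
  exact: not_copies.
have cfn3 := @cfn3P R G G_cubic M M_factor v.
pose flow4 (N : {set edge G}) := has_flow (4 : R) N /\ ~ cocut N.
have cfn4 : forall sigma : edge G -> int, is_signature sigma ->
    circular_flow_number R sigma = 4%:E <-> flow4 (negative_edges sigma) :=
  @cfn4P R G G_cubic M M_factor v.
have bip_colorable : bipartite G -> edge_colorable G 3.
  case/existsP => A /forallP A1; apply: (bipartite_colorable G_cubic (A := A)) M_factor.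
  by apply/setP => e; rewrite !inE A1.
split; first exact: (smallest_minimal_exists cfn3 (cocut_all G)).
split.
  have [N [Nf Nc]] : exists N : {set edge G}, has_flow (4 : R) N /\ ~ cocut N.
    case: (boolP (bipartite G)) => bip.
      by have [N [? ?]] := bipartite_four_flow R G_cubic bip M_factor va vb ab; exists N.
    case: (boolP (edge_colorable G 3)) => col.
      exists finset.set0; split; first exact: colorable_flow.
      by move/cocut0_bipartite; apply/negP.
    have F_factor := factorC G_cubic M_factor isT; have /factorP F2 := F_factor.
    have [s [s_v s_e]] :=
      half_edge_signs (fun v => subsetIr (~: M) (inc v)) (fun v => eq_leq (F2 v)).
    by have [N [? ? _]] := broken_not_cocut R G_cubic F_factor s_v s_e col; exists N.
  exact: (smallest_minimal_exists cfn4 (conj Nf Nc : flow4 N)).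
move=> X3 X4 /(is_smallest_minimalP cfn3)[X3c X3min] /(is_smallest_minimalP cfn4)[[X4f X4c] X4min] n alpha.
have X3_alpha : #|X3|%:R <= 3 * (2^-1 * n - alpha).
  have := smallest_cocut_alpha G_cubic X3min; have := card_edges G_cubic.
  move=> E le; have : (2 * (#|X3| + 3 * independence_number G) <= 3 * #|vertex G|)%N by rewrite -E leq_mul2l.
  by rewrite -(ler_nat R) !natrM natrD natrM -/n -/alpha; lra.
have X3_half : #|X3|%:R <= 2^-1 * n.
  have := smallest_cocut_half G_cubic X3c X3min.
  by rewrite -(ler_nat R) natrM -/n; lra.
have X3_min : #|X3|%:R <= Num.min (3 * (2^-1 * n - alpha)) (2^-1 * n).
  by rewrite le_min X3_alpha.
have X4_odd : ~~ edge_colorable G 3 -> (#|X4| <= oddness G)%N.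
  by move=> nc; apply: (@leq_oddness G R) => // [|N Nf Nc]; [exact: max_card|apply: X4min].
have X4_res : (resistance G <= #|X4|)%N by apply: resistance_le X4f.
have X3_neq0 : ~~ bipartite G -> X3 != finset.set0.
  by apply: contraNneq => X30; apply: cocut0_bipartite; rewrite -X30.
split.
- move=> bip; split.
    by apply/eqP; rewrite -leqn0 -(@cards0 (edge G)); apply/X3min/cocut0.
  apply/eqP; rewrite eqn_leq; apply/andP; split.
    by have [N [Nf Nc <-]] := bipartite_four_flow R G_cubic bip M_factor va vb ab; apply: X4min.
  case E: #|X4| => [|[|//]].
    by case: X4c; have /eqP := E; rewrite cards_eq0 => /eqP->; apply: cocut0.
  by have /eqP/cards1P[e Ee] := E; case: (@no_flow_single R G 4 e); rewrite -Ee.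
- move=> col nbip; split=> //.
    have := X3_neq0 nbip; rewrite -card_gt0; case E: #|X3| => [|[|//]] // _.
    have /eqP/cards1P[e Ee] := E; case: (@no_flow_single R G 3 e); rewrite -Ee.
    by have [A ->] := X3c; apply: cut_flow M_factor.
  apply/eqP; rewrite -leqn0 -(@cards0 (edge G)); apply: X4min; split; first exact: colorable_flow.
  by move/cocut0_bipartite; apply/negP.
- move=> nc; split; rewrite ?X4_odd //.
  by apply: leq_trans (oddness_le_cocut G_cubic M_factor X3c) _; rewrite subset_leq_card ?subsetDl.
- case/and3P => _ bl nc; split; rewrite ?X4_odd //.
  have /set0Pn[e eX] : X3 != finset.set0 by apply/X3_neq0; apply: contra nc.
  have [M' M'_factor eM'] := edge_in_factor e G_cubic bl M_factor.
  apply: leq_ltn_trans (oddness_le_cocut G_cubic M'_factor X3c) _.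
  apply: proper_card; rewrite properE subsetDl; apply/fintype.subsetPn.
  by exists e; rewrite // inE eM'.
Qed.
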